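(* Let $d\ge 3$ be a fixed integer. Suppose $k=k(n)$ is a function of $n$, with positive integer values, satisfying $k\prec\sqrt n$. Fix $\epsilon>0$. Then $$\mathbb{P}_n\left[N_{simp}(k)\ge (1-\epsilon)\,N_{prim}(k)\right]\to 1$$ as $n\to\infty$.
   Context: Asymptotics: $A\prec B$ means $A=o(B)$, i.e. $A/B\to0$, as $n\to\infty$. When $d$ is odd, $n\to\infty$ along even integers only. Random model: $G(d,n)$ is the random $d$-regular multigraph on $n$ vertices given by the configuration model: attach $d$ half-edges to each of the $n$ vertices; repeatedly choose some unpaired half-edge and pair it with a different unpaired half-edge chosen uniformly at random, until all are paired (equivalently, take a uniformly random perfect matching of the $nd$ half-edges). Each pair is an edge; self-loops and multiple edges are allowed, and the result is still called a graph. $\mathbb{P}_n$ denotes probability with respect to $\Gamma$ drawn from $G(d,n)$. Each edge, including each self-loop, has two distinct orientations, so each vertex is the initial vertex of exactly $d$ oriented edges; $\overline e$ denotes the oriented edge $e$ with orientation reversed. Walks and loops: a walk of length $k$ is a sequence of oriented edges $e_1e_2\cdots e_k$ with the terminal vertex of $e_i$ equal to the initial vertex of $e_{i+1}$ for $1\le i\le k-1$. It is a loop if the terminal vertex of $e_k$ equals the initial vertex of $e_1$; two loops whose edge sequences differ by a cyclic shift are considered the same loop (a loop and its reversal are not identified). A walk is non-backtracking if $\overline{e_i}\ne e_{i+1}$ for $1\le i\le k-1$; a loop is non-backtracking if all walks associated to it (all cyclic shifts) are non-backtracking. A walk is simple if the terminal vertices of its edges are distinct, and a loop is simple if all (equivalently,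 any) of its associated walks are simple. A loop is primitive if it is not the repetition of a shorter loop. $N_{simp}(k)=N_{simp}(\Gamma,k)$ is the number of simple non-backtracking loops of length $k$ on $\Gamma$, and $N_{prim}(k)=N_{prim}(\Gamma,k)$ is the number of primitive non-backtracking loops of length $k$ on $\Gamma$. *)

(* Defs.v *)
From HB Require Import structures.
From mathcomp Require Import all_boot all_order all_algebra.

Set Implicit Arguments.
Unset Strict Implicit.
Unset Printing Implicit Defensive.

Import GRing.Theory.

(* The half-edges (v, i), i < d, are those attached to the vertex v < n. *)
Definition half_edge (d n : nat) : finType := ('I_n * 'I_d)%type.

(* A perfect matching of the half-edges is encoded as the fixed-point-free
   involution sending each half-edge to the one it is paired with. *)
Definition perfect_matching (d n : nat)
    (m : {ffun half_edge d n -> half_edge d n}) : bool :=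
  [forall h, (m h != h) && (m (m h) == h)].

(* The sample space of G(d, n). *)
Definition graph (d n : nat) : finType :=
  {m : {ffun half_edge d n -> half_edge d n} | perfect_matching m}.

(* The law of the configuration model is uniform on perfect matchings.  The
   value is 0 / 0 = 0 when n * d is odd, as [graph d n] is then empty. *)
Definition Pr (R : fieldType) (d n : nat) (A : {set graph d n}) : R :=
  (#|A|%:R / #|graph d n|%:R)%R.

(* The values of n for which G(d, n) is defined: every n > 0 if d is even, the
   even ones if d is odd. *)
Definition admissible (d n : nat) : Prop := 0 < n /\ ~~ odd (n * d).

Section Loops.

Variables (d n : nat) (G : graph d n).

(* An oriented edge is identified with the half-edge from which it departs, so
   that each edge, self-loops included, has two distinct orientations. *)
Let edge : finType := half_edge d n.

Definition reverse (e : edge) : edge := val G e.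
Definition initial (e : edge) : 'I_n := e.1.
Definition terminal (e : edge) : 'I_n := (reverse e).1.

(* Unlike [sorted], [cycle] also compares the last edge with the first one. *)
Definition closed_walk (w : seq edge) : bool :=
  cycle (fun e f => terminal e == initial f) w.

Definition nonbacktracking_walk (w : seq edge) : bool :=
  sorted (fun e f => reverse e != f) w.

Definition simple_walk (w : seq edge) : bool := uniq (map terminal w).

Section FixedLength.

Variable k : nat.

Definition loop_of (w : k.-tuple edge) : {set k.-tuple edge} :=
  [set [tuple of rot i w] | i : 'I_k].

(* A loop is a set of closed walks: a class modulo cyclic shifts. *)
Definition loops : {set {set k.-tuple edge}} :=
  [set loop_of w | w : k.-tuple edge & closed_walk w].

Definition nonbacktracking (L : {set k.-tuple edge}) : bool :=
  [forall w in L, nonbacktracking_walk (tval w)].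

Definition simple (L : {set k.-tuple edge}) : bool :=
  [forall w in L, simple_walk (tval w)].

(* Some representative w of L is s ++ ... ++ s (j times), for a closed walk s
   of length l < k; the bound on j loses nothing, as j * l = k. *)
Definition repetition (L : {set k.-tuple edge}) : bool :=
  [exists w in L, exists l : 'I_k, exists s : l.-tuple edge,
     exists j : 'I_k.+1, closed_walk s && (tval w == flatten (nseq j (tval s)))].

Definition primitive (L : {set k.-tuple edge}) : bool := ~~ repetition L.

Definition N_simp : nat :=
  #|[set L in loops | nonbacktracking L && simple L]|.

Definition N_prim : nat :=
  #|[set L in loops | nonbacktracking L && primitive L]|.

End FixedLength.

End Loops.

(* Main.v *)
Require Import Defs.
From HB Require Import structures.
From mathcomp Require Import all_classical all_reals all_analysis.
From mathcomp Require Import all_boot all_order all_fingroup all_algebra.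
From mathcomp Require Import zify ring lra.

(** A loop of length [k] is a word of [k] half-edges up to rotation, and there are
    about [(d - 1) ^ k / k] simple nonbacktracking loops. The primitive loops that are
    not simple have to be shown to be fewer by a factor tending to 0.

    Everything about the random matching comes from exposing it along a walk: given
    the pairs already seen, an unmatched half-edge is matched to a nearly uniform free
    one ([prob_cons_ub], [prob_cons_lb]). An expected number of walks is thus a product
    of one factor per step ([ntraj_ub], [ntraj_lb]), with an additional factor of order
    [1 / n] for each fresh edge that has to land on a prescribed point.

    The number of simple words is concentrated around [(d - 1) ^ k] as soon as [k] tends
    to infinity, by a second moment computation ([Ex_simple_density_var]). Pairs of
    loops that share an edge contribute little: unless the second loop follows the
    first one entirely, it has a rotation that begins on the first one and closes with a
    fresh edge, so that these pairs amount to a proportion of order [k ^ 2 / n]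
    ([simple_pairs_le]).

    A word that is neither simple nor a power contains two fresh edges that land on
    visited vertices, as a nonbacktracking closed walk around a single cycle is a power
    of it ([tangled_collisions]). Hence such words are a proportion of order [k ^ 4 / n]
    at most ([Ex_tangled_small]), which settles the case where [k] is bounded or of
    order [log n].

    For larger [k] this estimate is too weak, and mixing replaces it. Let [P] be the
    transition matrix of the nonbacktracking walk; the number of closed words is
    [(d - 1) ^ k] times the trace of [P ^ k]. As [P] is doubly stochastic, the trace of
    [P ^ k] for [2 a <= k] is at most the squared Frobenius norm of [P ^ a]
    ([mxtrace_walk_le]). That squared norm is an explicit combination of the traces of the
    [P ^ (2 l)] for [l <= a] ([walk_frobS], [walk_reverseS]), whose means are bounded by
    the estimates for short words ([Ex_trace_even]). With [a] of order [log n] it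
    is 1 + o(1) in mean ([Ex_walk_frob_ub]), so that there are at most
    [(1 + o(1)) (d - 1) ^ k] closed words, hence at most that number divided by [k] of
    primitive loops, which is the number of simple ones. *)

Set Implicit Arguments.
Unset Strict Implicit.
Unset Printing Implicit Defensive.

Import Order.TTheory GRing.Theory Num.Theory.
Local Open Scope ring_scope.

Local Notation cycle := path.cycle.

(** * Conditional laws in the configuration model *)

Section Matching.
Variables (d n : nat).
Local Notation H := (half_edge d n).
Implicit Types (G : graph d n) (h : seq (H * H)) (x y z : H).

Lemma card_half_edge : #|{: H}| = (n * d)%N.
Proof. by rewrite card_prod !card_ord. Qed.

Lemma matchK G : involutive (val G).
Proof. by move=> x; have /forallP/(_ x)/andP[_ /eqP] := valP G. Qed.

Lemma match_neq G x : val G x != x.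
Proof. by have /forallP/(_ x)/andP[] := valP G. Qed.

Lemma match_inj G : injective (val G).
Proof. exact: inv_inj (matchK G). Qed.

Lemma match_swap G x y : (val G x == y) = (val G y == x).
Proof. by apply/eqP/eqP => <-; rewrite matchK. Qed.

Lemma graph_nonempty : ~~ odd (n * d) -> (0 < #|graph d n|)%N.
Proof.
move=> ev.
(* Matching the half-edges of ranks 2i and 2i + 1. *)
have evc : ~~ odd #|{: H}| by rewrite card_half_edge.
pose flip (i : nat) := if odd i then i.-1 else i.+1.
have flip_lt (i : 'I_#|{: H}|) : (flip i < #|{: H}|)%N.
  rewrite /flip; case: ifP => oi; first by have := ltn_ord i; lia.
  have := ltn_ord i; rewrite leq_eqVlt => /orP[/eqP e|//].
  by case/negP: evc; rewrite -[X in odd X]e /= oi.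
pose f x := enum_val (Ordinal (flip_lt (enum_rank x))).
have fP : perfect_matching [ffun x => f x].
  apply/forallP => x; rewrite !ffunE /f; apply/andP; split.
    apply/eqP => e; have := congr1 (fun z => val (enum_rank z)) e.
    rewrite enum_valK /= /flip; move: (nat_of_ord _) => j.
    by case: ifP => [|_ /eqP]; [case: j => //= j _ /eqP|]; rewrite ?eqn_leq ?ltnn ?andbF.
  apply/eqP; rewrite enum_valK; apply: enum_rank_inj; rewrite enum_valK.
  apply: val_inj => /=; rewrite /flip; move: (nat_of_ord _) => j.
  case: (boolP (odd j)) => [|/negbTE oj]; last by rewrite /= oj.
  by case: j => //= j /negbTE ->.
by apply/card_gt0P; exists (Sub _ fP : graph d n).
Qed.

(** All the uniformity used below comes from this symmetry of the sample space
    under relabellings of the half-edges. *)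
Fact conj_perfect (s : {perm H}) G :
  perfect_matching [ffun x => s (val G ((s^-1)%g x))].
Proof.
apply/forallP => x; rewrite !ffunE permK matchK permKV eqxx andbT.
by rewrite -{2}(permKV s x) (inj_eq perm_inj) match_neq.
Qed.

Definition conj_graph s G : graph d n := Sub _ (conj_perfect s G).

Lemma conj_graphE s G x : val (conj_graph s G) (s x) = s (val G x).
Proof. by rewrite /= ffunE permK. Qed.

Lemma conj_graph_inj s : injective (conj_graph s).
Proof.
move=> G1 G2 e; apply: val_inj; apply/ffunP => x.
by apply: (@perm_inj _ s); rewrite -!conj_graphE e.
Qed.

(** A history [h] lists pairs of half-edges known to be matched; a half-edge
    outside [halves h] is called fresh. *)
Definition extends h G : bool := all (fun p => val G p.1 == p.2) h.

Definition halves h : seq H := [seq p.1 | p <- h] ++ [seq p.2 | p <- h].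

Lemma size_halves h : size (halves h) = (2 * size h)%N.
Proof. by rewrite size_cat !size_map mul2n addnn. Qed.

Lemma conj_extends (s : {perm H}) h G :
  {in halves h, forall z, s z = z} -> extends h G -> extends h (conj_graph s G).
Proof.
move=> sK /allP hG; apply/allP => p ph; have /eqP e := hG p ph.
rewrite -{1}(sK p.1) ?conj_graphE ?e ?sK // /halves mem_cat map_f ?orbT //.
Qed.

Section Expectation.
Variable R : realFieldType.
Implicit Types f g : graph d n -> R.

Definition Ex f : R := (\sum_G f G) / #|graph d n|%:R.

Definition prob h : R := Ex (fun G => (extends h G)%:R).

Lemma PrE (A : {set graph d n}) : Pr R A = Ex (fun G => (G \in A)%:R).
Proof. by rewrite /Pr /Ex -natr_sum -big_mkcond sum1_card. Qed.

Lemma Ex_le f g : (forall G, f G <= g G) -> Ex f <= Ex g.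
Proof. by move=> fg; apply: ler_wpM2r; rewrite ?invr_ge0 // ler_sum. Qed.

Lemma eq_Ex f g : (forall G, f G = g G) -> Ex f = Ex g.
Proof. by move=> fg; congr (_ / _); apply: eq_bigr => G _. Qed.

Lemma Ex_ge0 f : (forall G, 0 <= f G) -> 0 <= Ex f.
Proof. by move=> f0; rewrite divr_ge0 // sumr_ge0. Qed.

Lemma Ex_sum (I : Type) (r : seq I) (P : pred I) (F : I -> graph d n -> R) :
  Ex (fun G => \sum_(i <- r | P i) F i G) = \sum_(i <- r | P i) Ex (F i).
Proof. by rewrite /Ex exchange_big /= mulr_suml. Qed.

Lemma ExD f g : Ex (fun G => f G + g G) = Ex f + Ex g.
Proof. by rewrite /Ex big_split mulrDl. Qed.

Lemma ExZ a f : Ex (fun G => a * f G) = a * Ex f.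
Proof. by rewrite /Ex -mulr_sumr mulrA. Qed.

Lemma Ex_cst a : ~~ odd (n * d) -> Ex (fun=> a) = a.
Proof.
move=> ev; rewrite /Ex sumr_const -[_ *+ _]mulr_natr mulfK //.
by rewrite pnatr_eq0 -lt0n graph_nonempty.
Qed.

Lemma prob_ge0 h : 0 <= prob h.
Proof. by apply: Ex_ge0 => G; rewrite ler0n. Qed.

Lemma prob_nil : ~~ odd (n * d) -> prob [::] = 1.
Proof. by move=> ev; rewrite /prob /extends /= Ex_cst. Qed.

Lemma Ex_split_match h x (F : H -> graph d n -> R) :
  Ex (fun G => (extends h G)%:R * F (val G x) G) =
  \sum_y Ex (fun G => (extends ((x, y) :: h) G)%:R * F y G).
Proof.
rewrite -Ex_sum; congr (_ / _); apply: eq_bigr => G _.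
rewrite (bigD1 (val G x)) //= eqxx /= big1 ?addr0 // => y yG.
by rewrite eq_sym (negbTE yG) mul0r.
Qed.

Lemma prob_split h x : \sum_y prob ((x, y) :: h) = prob h.
Proof.
have := Ex_split_match h x (fun _ _ => 1).
rewrite /prob => e; transitivity (Ex (fun G => (extends h G)%:R * 1)).
  by rewrite e; apply: eq_bigr => y _; congr (_ / _); apply: eq_bigr => G _;
     rewrite mulr1.
by congr (_ / _); apply: eq_bigr => G _; rewrite mulr1.
Qed.

(** Exchanging [y] and [z] by conjugation maps the matchings that extend
    [(x, y) :: h] into those that extend [(x, z) :: h]. *)
Lemma prob_exchange h x y z :
  y \notin halves h -> z \notin halves h -> y != x -> z != x ->
  prob ((x, y) :: h) <= prob ((x, z) :: h).
Proof.
move=> yh zh yx zx; apply: ler_wpM2r; first by rewrite invr_ge0.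
rewrite -!natr_sum ler_nat -!big_mkcond !sum1_card /=.
rewrite -(card_image (@conj_graph_inj (tperm y z))).
apply: subset_leq_card; apply/subsetP => _ /imageP[G Gh ->].
move: Gh => /andP[/eqP Gx Gh]; apply/andP; split; last first.
  apply: conj_extends Gh => t th; rewrite tpermD //.
    by apply: contraNneq yh => ->.
  by apply: contraNneq zh => ->.
by have := conj_graphE (tperm y z) G x; rewrite Gx tpermL tpermD // => /eqP.
Qed.

(** A matching is an involution without fixed points. *)
Lemma prob_taken h x y : x \notin halves h ->
  (y \in halves h) || (y == x) -> prob ((x, y) :: h) = 0.
Proof.
move=> xh yt; rewrite /prob /Ex big1 ?mul0r // => G _.
case: (boolP (extends _ _)) => //= /andP[/eqP Gx /allP hG]; exfalso.
case/orP: yt => [|/eqP e]; last by move: (match_neq G x); rewrite Gx e eqxx.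
rewrite mem_cat => /orP[] /mapP[p ph e]; have /eqP Gp := hG p ph;
  case/negP: xh; rewrite mem_cat; apply/orP.
  by right; apply/mapP; exists p => //; rewrite -Gp -e -Gx matchK.
left; apply/mapP; exists p => //; apply: (@match_inj G).
by rewrite Gx Gp.
Qed.

Definition free h x y := (y \notin halves h) && (y != x).

Lemma card_free h x : (n * d <= #|[pred y | free h x y]| + 2 * size h + 1)%N.
Proof.
rewrite -card_half_edge -(size_halves h) -addnA addn1.
have -> : #|{: H}| = (#|[pred y | free h x y]| + #|[predC free h x]|)%N.
  by rewrite cardC.
rewrite leq_add2l -[X in (_ <= X)%N]/(size (x :: halves h)).
apply: leq_trans (card_size _); apply: subset_leq_card.
apply/subsetP => y; rewrite !inE /free negb_and !negbK => /orP[->|->] //.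
by rewrite orbT.
Qed.

(** A half-edge not yet matched is matched to a uniform one among the free
    ones, of which there are at least [n * d - 2 * size h - 1]. *)
Lemma prob_cons_ub h x y : x \notin halves h ->
  ((n * d)%:R - (2 * size h + 1)%:R) * prob ((x, y) :: h) <= prob h.
Proof.
move=> xh; case: (boolP (free h x y)) => [/andP[yh yx]|]; last first.
  rewrite negb_and !negbK => yt.
  by rewrite prob_taken // mulr0 prob_ge0.
apply: (@le_trans _ _ (\sum_(z | free h x z) prob ((x, y) :: h))).
  rewrite sumr_const -[leRHS]mulr_natl ler_wpM2r ?prob_ge0 //.
  by rewrite lerBlDr -natrD ler_nat addnA card_free.
apply: (@le_trans _ _ (\sum_(z | free h x z) prob ((x, z) :: h))).
  by apply: ler_sum => z /andP[zh zx]; apply: prob_exchange.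
rewrite -[leRHS](prob_split h x) [leRHS](bigID (free h x)) /= lerDl.
by apply: sumr_ge0 => z _; apply: prob_ge0.
Qed.

(** The same symmetry from below: at most [n * d] partners share the weight. *)
Lemma prob_cons_lb h x y : x \notin halves h -> free h x y ->
  prob h <= (n * d)%:R * prob ((x, y) :: h).
Proof.
move=> xh /andP[yh yx]; rewrite -[leLHS](prob_split h x).
rewrite -card_half_edge mulr_natl -sumr_const; apply: ler_sum => z _.
case: (boolP (free h x z)) => [/andP[zh zx]|]; first exact: prob_exchange.
rewrite negb_and !negbK => zt.
by rewrite prob_taken ?prob_ge0.
Qed.

End Expectation.
End Matching.

(** * Trajectories exposed step by step *)

Section Tuples.
Variable T : finType.

Lemma big_tuple_cons (V : nmodType) k (F : k.+1.-tuple T -> V) :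
  \sum_w F w = \sum_x \sum_(w : k.-tuple T) F [tuple of x :: w].
Proof.
rewrite pair_big /=.
rewrite (reindex (fun p : T * k.-tuple T => [tuple of p.1 :: p.2])) //=.
exists (fun w => (thead w, [tuple of behead w])) => [[x w] _|w _] /=.
  by congr (_, _); apply: val_inj.
by rewrite -tuple_eta.
Qed.

Lemma big_tuple_cat (V : nmodType) a b (F : seq T -> V) :
  \sum_(w : (a + b).-tuple T) F w =
  \sum_(u : a.-tuple T) \sum_(v : b.-tuple T) F (u ++ v).
Proof.
elim: a F => [|a IH] F.
  rewrite (big_pred1 [tuple]) // => u.
  by apply/esym/eqP; apply: tuple0.
rewrite big_tuple_cons [RHS]big_tuple_cons; apply: eq_bigr => x _.
exact: (IH (fun w => F (x :: w))).
Qed.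

Lemma tuple_inhabited k (w : k.-tuple T) : (0 < k)%N -> exists x : T, true.
Proof. by case: (tval w) (size_tuple w) => [<-|x _ _ _] //; exists x. Qed.

End Tuples.

Section Exposure.
Variables (d n : nat).
Local Notation H := (half_edge d n).
Implicit Types (G : graph d n) (h : seq (H * H)) (x y z : H) (w : seq H).
Implicit Types s : seq (H * H) -> H -> H -> bool.

(** The half-edges of [w] are followed one after the other across the matching,
    and the pairs met so far, the latest one first, form the history that the
    constraint [s] on the next pair may depend upon. *)
Fixpoint traj G s h w : bool :=
  if w is x :: w' then s h x (val G x) && traj G s ((x, val G x) :: h) w'
  else true.

Definition history G w : seq (H * H) := [seq (x, val G x) | x <- rev w].

Lemma size_history G w : size (history G w) = size w.
Proof. by rewrite size_map size_rev. Qed.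

Lemma history_rcons G w x : history G (rcons w x) = (x, val G x) :: history G w.
Proof. by rewrite /history rev_rcons. Qed.

Lemma history_cat G w1 w2 : history G (w1 ++ w2) = history G w2 ++ history G w1.
Proof. by rewrite /history rev_cat map_cat. Qed.

Lemma traj_cat G s h w1 w2 :
  traj G s h (w1 ++ w2) = traj G s h w1 && traj G s (history G w1 ++ h) w2.
Proof.
elim: w1 h => [|x w1 IH] h //=; rewrite IH andbA; congr (_ && traj _ _ _ _).
by rewrite -[x :: w1]cat1s history_cat /= -catA.
Qed.

Lemma traj_rcons G s h w x :
  traj G s h (rcons w x) = traj G s h w && s (history G w ++ h) x (val G x).
Proof. by rewrite -cats1 traj_cat /= andbT. Qed.

Lemma trajP G s h w x0 :
  reflect (forall i, (i < size w)%N ->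
             s (history G (take i w) ++ h) (nth x0 w i) (val G (nth x0 w i)))
          (traj G s h w).
Proof.
elim/last_ind: w => [|w x IH]; first by apply: ReflectT.
rewrite traj_rcons; apply: (iffP andP) => [[/IH tw sx] i|tw].
  rewrite size_rcons ltnS leq_eqVlt => /orP[/eqP ->|iw].
    by rewrite nth_rcons ltnn eqxx -cats1 take_size_cat.
  by rewrite nth_rcons iw -cats1 takel_cat 1?ltnW //; apply: tw.
split; last first.
  have := tw (size w); rewrite size_rcons ltnSn nth_rcons ltnn eqxx -cats1.
  by rewrite take_size_cat //; apply.
apply/IH => i iw; have := tw i; rewrite size_rcons ltnS (ltnW iw) nth_rcons iw.
by rewrite -cats1 takel_cat 1?ltnW //; apply.
Qed.

Variable R : realFieldType.
Local Notation prob := (@prob d n R).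
Local Notation Ex := (@Ex d n R).

Definition ntraj G s h k : R := \sum_(w : k.-tuple H) (traj G s h w)%:R.

(** Summing over the partner [y] of [x] turns the indicator of
    [val G x = y] into the law of the partner given the history. *)
Lemma Ex_ntrajS s h k :
  Ex (fun G => (extends h G)%:R * ntraj G s h k.+1) =
  \sum_x \sum_(y | s h x y)
     Ex (fun G => (extends ((x, y) :: h) G)%:R * ntraj G s ((x, y) :: h) k).
Proof.
under [RHS]eq_bigr do rewrite big_mkcond /=.
transitivity (\sum_x Ex (fun G => (extends h G)%:R *
   ((s h x (val G x))%:R * ntraj G s ((x, val G x) :: h) k))).
  rewrite -Ex_sum; congr (_ / _); apply: eq_bigr => G _.
  rewrite /ntraj big_tuple_cons mulr_sumr; apply: eq_bigr => x _.
  congr (_ * _); rewrite mulr_sumr; apply: eq_bigr => w _ /=.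
  by case: (s h x _); rewrite /= ?mul1r ?mul0r.
apply: eq_bigr => x _.
rewrite (Ex_split_match h x
  (fun y G => (s h x y)%:R * ntraj G s ((x, y) :: h) k)).
apply: eq_bigr => y _; case: (s h x y).
  by congr (_ / _); apply: eq_bigr => G _; rewrite mul1r.
rewrite /Ex big1 ?mul0r // => G _.
by rewrite mul0r mulr0.
Qed.

Lemma Ex_ntraj0 s h : Ex (fun G => (extends h G)%:R * ntraj G s h 0) = prob h.
Proof.
congr (_ / _); apply: eq_bigr => G _; rewrite /ntraj (big_pred1 [tuple]).
  by rewrite mulr1.
by move=> w; apply/esym/eqP; apply: tuple0.
Qed.

(** By induction on the first pair, whose conditional weight factors out. The
    bound [b] is indexed by the number of pairs already known. *)
Lemma ntraj_ub s (b : nat -> R) k h :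
  (forall i, 0 <= b i) ->
  (forall h', (size h <= size h' < size h + k)%N ->
     \sum_x \sum_(y | s h' x y) prob ((x, y) :: h') <= b (size h') * prob h') ->
  Ex (fun G => (extends h G)%:R * ntraj G s h k) <=
  (\prod_(size h <= i < size h + k) b i) * prob h.
Proof.
move=> b0; elim: k h => [|k IH] h bP.
  by rewrite Ex_ntraj0 addn0 big_geq // mul1r.
rewrite Ex_ntrajS big_ltn ?addnS ?ltnS ?leq_addr //.
set B := \prod_(_ <= i < _) _.
have B0 : 0 <= B by apply: prodr_ge0.
apply: (@le_trans _ _ (\sum_x \sum_(y | s h x y) B * prob ((x, y) :: h))).
  apply: ler_sum => x _; apply: ler_sum => y _.
  rewrite /B -addSn; apply: (IH ((x, y) :: h)) => h' /andP[h1 h2].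
  by apply: bP; move: h1 h2; rewrite /= addSn addnS => h1 h2; rewrite ltnW.
under eq_bigr do rewrite -mulr_sumr.
rewrite -mulr_sumr -mulrA mulrCA ler_wpM2l //.
by apply: bP; rewrite leqnn addnS ltnS leq_addr.
Qed.

(** The invariant [I] records what makes the lower bound on the weights valid. *)
Lemma ntraj_lb s (I : seq (H * H) -> Prop) (b : nat -> R) k h :
  (forall i, 0 <= b i) -> I h ->
  (forall h' x y, I h' -> s h' x y -> I ((x, y) :: h')) ->
  (forall h', I h' -> (size h <= size h' < size h + k)%N ->
     b (size h') * prob h' <= \sum_x \sum_(y | s h' x y) prob ((x, y) :: h')) ->
  (\prod_(size h <= i < size h + k) b i) * prob h <=
  Ex (fun G => (extends h G)%:R * ntraj G s h k).
Proof.
move=> b0 + Is; elim: k h => [|k IH] h Ih bP.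
  by rewrite Ex_ntraj0 addn0 big_geq // mul1r.
rewrite Ex_ntrajS big_ltn ?addnS ?ltnS ?leq_addr //.
set B := \prod_(_ <= i < _) _.
have B0 : 0 <= B by apply: prodr_ge0.
apply: (@le_trans _ _ (\sum_x \sum_(y | s h x y) B * prob ((x, y) :: h))).
  under eq_bigr do rewrite -mulr_sumr.
  rewrite -mulr_sumr -mulrA mulrCA ler_wpM2l //.
  by apply: bP; rewrite // leqnn addnS ltnS leq_addr.
apply: ler_sum => x _; apply: ler_sum => y sxy.
rewrite /B -addSn; apply: (IH ((x, y) :: h)); first exact: Is.
move=> h' Ih' /andP[h1 h2].
by apply: bP; move: h1 h2; rewrite //= addSn addnS => h1 h2; rewrite ltnW.
Qed.

Lemma ntraj_ub0 s (b : nat -> R) k : ~~ odd (n * d) ->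
  (forall i, 0 <= b i) ->
  (forall h, (size h < k)%N ->
     \sum_x \sum_(y | s h x y) prob ((x, y) :: h) <= b (size h) * prob h) ->
  Ex (fun G => ntraj G s [::] k) <= \prod_(i < k) b i.
Proof.
move=> ev b0 bP; have := @ntraj_ub s b k [::] b0 bP.
rewrite prob_nil // mulr1 big_mkord; apply: le_trans.
by rewrite le_eqVlt; apply/orP; left; apply/eqP; congr (_ / _);
  apply: eq_bigr => G _; rewrite mul1r.
Qed.

Lemma ntraj_lb0 s (I : seq (H * H) -> Prop) (b : nat -> R) k :
  ~~ odd (n * d) -> (forall i, 0 <= b i) -> I [::] ->
  (forall h x y, I h -> s h x y -> I ((x, y) :: h)) ->
  (forall h, I h -> (size h < k)%N ->
     b (size h) * prob h <= \sum_x \sum_(y | s h x y) prob ((x, y) :: h)) ->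
  \prod_(i < k) b i <= Ex (fun G => ntraj G s [::] k).
Proof.
move=> ev b0 I0 Is bP; have := @ntraj_lb s I b k [::] b0 I0 Is bP.
rewrite prob_nil // mulr1 big_mkord; move/le_trans; apply.
by rewrite le_eqVlt; apply/orP; left; apply/eqP; congr (_ / _);
  apply: eq_bigr => G _; rewrite mul1r.
Qed.

(** The weight of a pair is small for two reasons: [x] has few choices, and a
    fresh [x] has to land in a small set. *)
Lemma weight_choice s (A : pred H) (B : H -> pred H) (a : nat) (b : R) h :
  (forall x y, s h x y -> A x && B x y) -> (#|A| <= a)%N -> 0 <= b ->
  (forall x, A x -> \sum_(y | B x y) prob ((x, y) :: h) <= b * prob h) ->
  \sum_x \sum_(y | s h x y) prob ((x, y) :: h) <= a%:R * b * prob h.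
Proof.
move=> sAB ca b0 bP.
apply: (@le_trans _ _ (\sum_(x | A x) b * prob h)); last first.
  rewrite sumr_const -[_ *+ _]mulr_natl mulrA ler_wpM2r ?prob_ge0 //.
  by rewrite ler_wpM2r // ler_nat.
rewrite [leRHS]big_mkcond /=; apply: ler_sum => x _; case: ifPn => Ax.
  apply: le_trans (bP x Ax); rewrite [leRHS]big_mkcond [leLHS]big_mkcond /=.
  apply: ler_sum => y _; case: ifP => [/sAB/andP[_ ->] //|_].
  by case: ifP; rewrite // prob_ge0.
by rewrite big_pred0 // => y; apply/negP => /sAB; rewrite (negbTE Ax).
Qed.

Lemma weight_any h x (B : pred H) : \sum_(y | B y) prob ((x, y) :: h) <= 1 * prob h.
Proof.
rewrite mul1r -[leRHS](prob_split R h x) [leRHS](bigID B) /= lerDl.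
by apply: sumr_ge0 => y _; apply: prob_ge0.
Qed.

Lemma weight_fresh h x (B : pred H) (c M : nat) :
  (size h < M)%N -> (2 * M < n * d)%N -> x \notin halves h -> (#|B| <= c)%N ->
  \sum_(y | B y) prob ((x, y) :: h) <= c%:R / ((n * d)%:R - (2 * M)%:R) * prob h.
Proof.
move=> hM MN xh Bc.
have N0 : 0 < (n * d)%:R - (2 * M)%:R :> R by rewrite subr_gt0 ltr_nat.
rewrite mulrAC ler_pdivlMr // mulrC mulr_sumr.
apply: (@le_trans _ _ (\sum_(y | B y) prob h)); last first.
  by rewrite sumr_const -[_ *+ _]mulr_natl ler_wpM2r ?prob_ge0 // ler_nat.
apply: ler_sum => y _; apply: le_trans (prob_cons_ub R y xh).
rewrite ler_wpM2r ?prob_ge0 // lerB // ler_nat; lia.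
Qed.

End Exposure.

(** * Words, rotations and loops *)

Section Words.
Variable T : eqType.
Implicit Types (t u v w : seq T) (e : rel T).

Lemma flatten_nseqD a b t :
  flatten (nseq (a + b) t) = flatten (nseq a t) ++ flatten (nseq b t).
Proof. by rewrite nseqD flatten_cat. Qed.

Lemma size_flatten_nseq a t : size (flatten (nseq a t)) = (a * size t)%N.
Proof. by elim: a => //= a IH; rewrite size_cat IH mulSn. Qed.

(** Euclid's algorithm on the lengths: the shorter word is a prefix of the longer
    one, and the remainder still commutes with it. *)
Lemma commuting_words u v : u ++ v = v ++ u -> u != [::] -> v != [::] ->
  exists t a b, u = flatten (nseq a.+1 t) /\ v = flatten (nseq b.+1 t).
Proof.
elim: (size u + size v)%N {-2}u {-2}v (leqnn (size u + size v)%N) => [|m IH] {}u {}v.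
  by case: u.
wlog suv : u v / (size u <= size v)%N.
  move=> wl sm uv u0 v0; case/orP: (leq_total (size u) (size v)) => [le|le].
    exact: wl.
  have [t [a [b [-> ->]]]] := wl v u le (etrans (congr1 (leq^~ _) (addnC _ _)) sm)
    (esym uv) v0 u0.
  by exists t, b, a.
move=> sm uv u0 v0.
have vE : v = u ++ drop (size u) v.
  by rewrite -[LHS](cat_take_drop (size u)); congr (_ ++ _);
     rewrite -(takel_cat u suv) -uv take_size_cat.
move: vE; set v' := drop _ _ => vE.
case: (eqVneq v' [::]) => [v'0|v'0].
  by exists u, 0%N, 0%N; rewrite /= cats0 vE v'0 cats0.
have uv' : u ++ v' = v' ++ u.
  by have /eqP := uv; rewrite vE -catA eqseq_cat // eqxx => /eqP.
have su : (0 < size u)%N by case: (u) u0.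
have [|t [a [b [uE v'E]]]] := IH u v' _ uv' u0 v'0.
  by move: sm; rewrite vE size_cat; lia.
by exists t, a, (a + b).+1; split => //; rewrite vE uE v'E -flatten_nseqD addSn addnS.
Qed.

(** The exponent is forced by the lengths, which makes the predicate boolean. *)
Definition proper_power w : bool :=
  [exists l : 'I_(size w), flatten (nseq (size w %/ l) (take l w)) == w].

Lemma proper_powerI w t a :
  w = flatten (nseq a t) -> (0 < size t < size w)%N -> proper_power w.
Proof.
move=> wE /andP[t0 tw]; apply/existsP; exists (Ordinal tw) => /=.
rewrite {1}wE size_flatten_nseq mulnK //.
case: a wE => [|a] wE; first by rewrite wE in tw.
have tk : take (size t) w = t by rewrite wE /= take_size_cat.
by rewrite tk -wE.
Qed.

Lemma proper_powerP w : proper_power w ->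
  exists t a, [/\ w = flatten (nseq a t), (0 < size t < size w)%N & (1 < a)%N].
Proof.
case/existsP => -[l lw] /= /eqP e; exists (take l w), (size w %/ l)%N.
have l0 : (0 < l)%N by case: l lw e => // lw; rewrite divn0 => e; rewrite -e in lw.
have st : size (take l w) = l by rewrite size_take lw.
split=> //; first by rewrite st l0.
have := congr1 size e; rewrite size_flatten_nseq st => e2.
by move: lw; rewrite -{1}e2 -{1}[l]mul1n ltn_mul2r l0.
Qed.

(** The two pieces exchanged by the rotation commute. *)
Lemma rot_fixed_power w i : rot i w = w -> (0 < i < size w)%N -> proper_power w.
Proof.
move=> rw /andP[i0 iw].
have w0 : w != [::] by rewrite -size_eq0 -lt0n (leq_ltn_trans _ iw).
have [|||t [a [b [uE vE]]]] := @commuting_words (drop i w) (take i w).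
- by rewrite cat_take_drop -[LHS]/(rot i w).
- by rewrite -size_eq0 size_drop subn_eq0 -ltnNge.
- by rewrite -size_eq0 size_take iw -lt0n.
have wE : w = flatten (nseq (b.+1 + a.+1) t).
  by rewrite flatten_nseqD -uE -vE cat_take_drop.
apply: proper_powerI (wE) _.
have t0 : (0 < size t)%N.
  rewrite lt0n; apply: contraNneq w0 => t0.
  by rewrite -size_eq0 wE size_flatten_nseq t0 muln0.
by rewrite t0 {1}wE size_flatten_nseq -{1}[size t]mul1n ltn_mul2r t0 addSn addnS.
Qed.

Lemma cycle_power e (a : nat) t : cycle e (flatten (nseq a.+1 t)) -> cycle e t.
Proof.
case: t => [|x p] //; case: a => [|a] /=; first by rewrite cats0.
rewrite -cats1 -catA /= cat_path => /andP[p1 /= /andP[p2 _]].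
by rewrite rcons_path p1.
Qed.

Lemma periodic_power w x0 p : (0 < p < size w)%N -> (p %| size w)%N ->
  (forall i, (i < size w)%N -> nth x0 w i = nth x0 w (i %% p)) -> proper_power w.
Proof.
move=> /andP[p0 pw] pd per; apply/existsP; exists (Ordinal pw) => /=.
apply/eqP; apply: (@eq_from_nth _ x0).
  by rewrite size_flatten_nseq size_take pw divnK.
move=> i; rewrite size_flatten_nseq size_take pw divnK // => iw.
rewrite per //; move: iw; rewrite -{1}(divnK pd); elim: (_ %/ _)%N i => [|a IH] i.
  by rewrite mul0n.
rewrite mulSn /= nth_cat size_take pw => ia; case: ltnP => ip.
  by rewrite nth_take // modn_small.
rewrite IH; last by rewrite ltn_subLR.
by rewrite -{2}(subnK ip) modnDr.
Qed.

End Words.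

Section Walks.
Variables (d n : nat) (G : graph d n).
Local Notation H := (half_edge d n).
Implicit Types (x y : H).

(** Consecutive steps of a nonbacktracking walk. A word that is a cycle for this
    relation is a closed walk all of whose rotations are nonbacktracking. *)
Definition nb : rel H := fun x y => ((val G x).1 == y.1) && (val G x != y).

Variable k : nat.

Definition closed_words : {set k.-tuple H} := [set w : k.-tuple H | cycle nb w].

Definition simple_words : {set k.-tuple H} :=
  [set w : k.-tuple H | (w \in closed_words) && uniq [seq x.1 | x <- w]].

(** The words that make up the difference between the two counts of loops. *)
Definition tangled_words : {set k.-tuple H} :=
  [set w : k.-tuple H | [&& w \in closed_words, ~~ uniq [seq x.1 | x <- w]
                          & ~~ proper_power w]].

Hypothesis k_gt0 : (0 < k)%N.

Lemma mem_loop_of (w w' : k.-tuple H) :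
  reflect (exists2 i, (i < k)%N & tval w' = rot i w) (w' \in loop_of w).
Proof.
apply: (iffP imsetP) => [[i _ ->]|[i ik e]]; first by exists i.
by exists (Ordinal ik) => //; apply: val_inj.
Qed.

Lemma loop_of_id (w : k.-tuple H) : w \in loop_of w.
Proof. by apply/mem_loop_of; exists 0%N; rewrite ?rot0. Qed.

Lemma loop_of_rot (w w' : k.-tuple H) i :
  tval w' = rot i w -> (i <= k)%N -> w' \in loop_of w.
Proof.
move=> e; rewrite leq_eqVlt => /orP[/eqP ik|ik]; apply/mem_loop_of.
  by exists 0%N => //; rewrite e ik -{1}(size_tuple w) rot_size rot0.
by exists i.
Qed.

Lemma loop_of_trans (w1 w2 w3 : k.-tuple H) :
  w2 \in loop_of w1 -> w3 \in loop_of w2 -> w3 \in loop_of w1.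
Proof.
move=> /mem_loop_of[i ik e2] /mem_loop_of[j jk e3].
move: e3; rewrite e2 rot_add_mod ?size_tuple ?(ltnW ik) ?(ltnW jk) // => e3.
by apply: loop_of_rot e3 _; case: ifP => // _; lia.
Qed.

Lemma loop_of_sym (w w' : k.-tuple H) : w' \in loop_of w -> w \in loop_of w'.
Proof.
move=> /mem_loop_of[i ik e]; apply: (@loop_of_rot _ _ (k - i)); last exact: leq_subr.
by rewrite e -{1}[tval w](rotK i) /rotr size_rot size_tuple.
Qed.

Lemma loop_of_eq (w w' : k.-tuple H) : w' \in loop_of w -> loop_of w' = loop_of w.
Proof.
move=> ww'; apply/setP => u; apply/idP/idP; first exact: loop_of_trans.
exact/loop_of_trans/loop_of_sym.
Qed.

Lemma closed_wordsE (w : k.-tuple H) :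
  (w \in closed_words) = closed_walk G w && nonbacktracking G (loop_of w).
Proof.
rewrite inE /closed_walk /nonbacktracking /nonbacktracking_walk.
have -> : cycle nb w = cycle (fun e f => terminal G e == initial f) w &&
                       cycle (fun e f => reverse G e != f) w.
  case: (tval w) => [|x p] //=; move: (rcons p x) => q.
  elim: q x => [|z q IH] x //=.
  rewrite IH /nb /terminal /initial /reverse.
  by rewrite -!andbA; congr andb; rewrite andbCA.
congr (_ && _); apply/idP/forall_inP => [cw w' /mem_loop_of[i _ ->]|sw].
  rewrite -(rot_cycle i) in cw; case: (rot i w) cw => [|x p] //=.
  by rewrite rcons_path => /andP[].
have sorted_rot i : (i <= k)%N -> sorted (fun e f => reverse G e != f) (rot i w).
  by move=> ik; apply: (sw [tuple of rot i w]); apply: loop_of_rot ik.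
have := sorted_rot k.-1 (leq_pred k); have := sorted_rot 0%N (leq0n k).
rewrite rot0; have := size_tuple w; case/lastP: (tval w) => [|p z] //.
rewrite size_rcons => <- /=; rewrite -cats1 rot_size_cat.
case: p => [|x p] /=; first by rewrite /reverse match_neq.
by rewrite rcons_path cats1 last_rcons => -> /andP[].
Qed.

Lemma loops_of_closed L :
  L \in loops G k -> nonbacktracking G L ->
  forall w, w \in L -> w \in closed_words /\ L = loop_of w.
Proof.
case/imsetP => w0; rewrite inE => cw ->{L} nw w ww.
rewrite (loop_of_eq ww) closed_wordsE (loop_of_eq ww) nw andbT; split => //.
case/mem_loop_of: ww => i _ ->.
by rewrite /closed_walk rot_cycle.
Qed.

Lemma closed_loop (w : k.-tuple H) : w \in closed_words ->
  loop_of w \in loops G k /\ nonbacktracking G (loop_of w).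
Proof.
rewrite closed_wordsE => /andP[cw nw]; split => //.
by apply/imsetP; exists w; rewrite ?inE.
Qed.

Lemma simple_walkE (w : k.-tuple H) : w \in closed_words ->
  simple_walk G w = uniq [seq x.1 | x <- w].
Proof.
rewrite closed_wordsE => /andP[cw _]; rewrite /simple_walk.
suff -> : [seq terminal G e | e <- w] = rot 1 [seq x.1 | x <- w] by rewrite rot_uniq.
case: (tval w) cw => [|x p] //=; rewrite rot1_cons /closed_walk /=.
have -> : rcons [seq y.1 | y <- p] x.1 = [seq y.1 | y <- rcons p x].
  by rewrite map_rcons.
elim: p x {2 4}x => [|y p IH] x z /= /andP[/eqP e]; first by rewrite e.
by move=> /IH <-; rewrite e.
Qed.

Lemma simple_rot (w : k.-tuple H) i :
  uniq [seq x.1 | x <- rot i w] = uniq [seq x.1 | x <- w].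
Proof. by rewrite map_rot rot_uniq. Qed.

Lemma simple_loopE (w : k.-tuple H) : w \in closed_words ->
  simple G (loop_of w) = uniq [seq x.1 | x <- w].
Proof.
move=> cw; have [lw nw] := closed_loop cw.
apply/forall_inP/idP => [sw|uw w' ww'].
  by rewrite -simple_walkE //; apply/sw/loop_of_id.
have [cw' _] := loops_of_closed lw nw ww'.
by rewrite simple_walkE //; case/mem_loop_of: ww' => i _ ->; rewrite simple_rot.
Qed.

Lemma proper_power_repetition (w : k.-tuple H) : w \in closed_words ->
  proper_power w -> repetition G (loop_of w).
Proof.
rewrite closed_wordsE => /andP[cw _] /proper_powerP[t [a [wE /andP[t0 tk] a1]]].
rewrite size_tuple in tk.
apply/exists_inP; exists w; first exact: loop_of_id.
apply/existsP; exists (Ordinal tk); apply/existsP; exists (in_tuple t) => /=.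
have ak : (a < k.+1)%N.
  by rewrite ltnS -(size_tuple w) wE size_flatten_nseq leq_pmulr.
apply/existsP; exists (Ordinal ak); rewrite /= -wE eqxx andbT.
by case: a wE a1 {ak} => // a wE _; move: cw; rewrite /closed_walk wE => /cycle_power.
Qed.

Lemma primitive_card_loop (w : k.-tuple H) : w \in closed_words ->
  primitive G (loop_of w) -> #|loop_of w| = k.
Proof.
move=> cw pw; rewrite card_in_imset ?card_ord // => i j _ _ /(congr1 val) /= e.
wlog ij : i j e / (i < j)%N.
  move=> wl; apply: val_inj; case: (ltngtP i j) => // ij; first by rewrite (wl i j).
  by rewrite (wl j i).
case/negP: pw; apply: proper_power_repetition => //.
apply: (@rot_fixed_power _ _ (j - i)); last by rewrite size_tuple; have := ltn_ord j; lia.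
have jk := ltn_ord j; have jik : (j - i <= k)%N by lia.
apply: (@rot_inj i); rewrite rot_add_mod ?size_tuple ?jik ?(ltnW (ltn_ord i)) //.
by rewrite subnKC ?(ltnW jk) ?(ltnW ij).
Qed.

(** A primitive loop that is not simple has a rotation that is tangled. *)
Lemma N_prim_le : (N_prim G k <= N_simp G k + #|tangled_words|)%N.
Proof.
set A := [set L in loops G k | nonbacktracking G L && simple G L].
have sub : [set L in loops G k | nonbacktracking G L && primitive G L] \subset
    A :|: [set loop_of w | w in tangled_words].
  apply/subsetP => L; rewrite !inE => /and3P[LL nL pL].
  rewrite LL nL /=; case: (boolP (simple G L)) => //= /forall_inPn[w wL sw].
  have [cw LE] := loops_of_closed LL nL wL.
  apply/imsetP; exists w => //; rewrite inE cw -simple_walkE // sw /=.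
  by apply: contra pL => /(proper_power_repetition cw); rewrite LE.
rewrite /N_prim; apply: leq_trans (subset_leq_card sub) _.
by apply: leq_trans (leq_card_setU _ _) _; rewrite leq_add2l leq_imset_card.
Qed.

Lemma sum_loops (P : pred {set k.-tuple H}) :
  (\sum_(L in loops G k | nonbacktracking G L && P L) #|L| =
   #|[set w in closed_words | P (loop_of w)]|)%N.
Proof.
rewrite -sum1_card; under eq_bigr do rewrite -sum1_card.
rewrite (exchange_big_dep (fun w => w \in [set w in closed_words | P (loop_of w)])) /=.
  apply: eq_bigr => w; rewrite inE => /andP[cw Pw].
  have [lw nw] := closed_loop cw.
  rewrite (big_pred1 (loop_of w)) // => L /=; apply/idP/eqP => [|->].
    by move=> /andP[/and3P[LL nL _] wL]; case: (loops_of_closed LL nL wL).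
  by rewrite lw nw Pw loop_of_id.
move=> L w /and3P[LL nL PL] wL; have [cw LE] := loops_of_closed LL nL wL.
by rewrite inE cw -LE.
Qed.

(** A primitive loop has [k] distinct rotations, a coincidence between two of
    them making it a power. *)
Lemma N_prim_closed : (k * N_prim G k <= #|closed_words|)%N.
Proof.
rewrite /N_prim mulnC -sum_nat_const.
rewrite (eq_bigl (fun L => (L \in loops G k) && (nonbacktracking G L && primitive G L)));
  last by move=> L; rewrite inE.
apply: (@leq_trans (\sum_(L in loops G k | nonbacktracking G L && primitive G L) #|L|)).
  apply: leq_sum => L /and3P[LL nL]; have [w0 _ e] := imsetP LL.
  have w0L : w0 \in L by rewrite e loop_of_id.
  by have [cw LE] := loops_of_closed LL nL w0L; rewrite LE => /(primitive_card_loop cw) ->.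
by rewrite sum_loops subset_leq_card //; apply/subsetP => w; rewrite inE => /andP[].
Qed.

Lemma simple_words_loops : (#|simple_words| <= k * N_simp G k)%N.
Proof.
have -> : simple_words = [set w in closed_words | simple G (loop_of w)].
  by apply/setP => w; rewrite !inE; apply: andb_id2l => cw; rewrite simple_loopE ?inE.
rewrite -sum_loops /N_simp mulnC -sum_nat_const.
rewrite [leqRHS](eq_bigl (fun L => (L \in loops G k) && (nonbacktracking G L && simple G L)));
  last by move=> L; rewrite inE.
apply: leq_sum => L /andP[/imsetP[w _ ->] _].
by rewrite -[X in (_ <= X)%N]card_ord leq_imset_card.
Qed.

End Walks.

(** * Simple loops: upper bound on the mean *)

Lemma cycle_nthP (T : Type) (e : rel T) (w : seq T) x0 :
  reflect (forall i, (i < size w)%N -> e (nth x0 w i) (nth x0 w (i.+1 %% size w)))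
          (cycle e w).
Proof.
case: w => [|x p]; first by apply: ReflectT.
apply: (iffP (pathP x0)); rewrite size_rcons => cw i iw; have := cw i iw.
  move: iw; rewrite ltnS leq_eqVlt => /orP[/eqP ->|ip].
    by rewrite modnn -{1}rcons_cons nth_rcons /= ltnSn nth_rcons ltnn eqxx.
  by rewrite modn_small // -{1}rcons_cons !nth_rcons /= ltnS (ltnW ip) ip.
move: iw; rewrite ltnS leq_eqVlt => /orP[/eqP ->|ip].
  by rewrite modnn -[x :: rcons _ _]rcons_cons !nth_rcons /= ltnSn ltnn eqxx.
by rewrite modn_small // -[x :: rcons _ _]rcons_cons !nth_rcons /= ltnS (ltnW ip) ip.
Qed.

Lemma uniq_map_inj (T1 T2 : eqType) (f : T1 -> T2) (s : seq T1) :
  uniq [seq f x | x <- s] -> {in s &, injective f}.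
Proof.
elim: s => [|z s IH] //= /andP[zs us] x y; rewrite !inE.
move=> /predU1P[->|xs] /predU1P[->|ys] // e; last exact: IH.
  by case/mapP: zs; exists y.
by case/mapP: zs; exists x.
Qed.

Section SimpleWords.
Variables (d n : nat).
Local Notation H := (half_edge d n).
Implicit Types (G : graph d n) (h : seq (H * H)) (x y z : H).
Implicit Types St : seq (H * H) -> pred H.

Lemma card_vertex_half_edges (v : 'I_n) : #|[pred x : H | x.1 == v]| = d.
Proof.
rewrite -[RHS]card_ord -(card_imset predT (_ : injective (fun i : 'I_d => (v, i)))).
  apply: eq_card => -[u i]; rewrite !inE /=; apply/eqP/imsetP => [->|[j _ [-> _]]//].
  by exists i.
by move=> i j [].
Qed.

Definition siblings x : pred H := [pred y | (y.1 == x.1) && (y != x)].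

Lemma card_siblings x : #|siblings x| = d.-1.
Proof.
have e := card_vertex_half_edges x.1; rewrite (cardD1 x) !inE eqxx /= in e.
suff: (1 + #|siblings x| = d)%N by move=> /(congr1 predn).
by rewrite -[RHS]e; congr addn; apply: eq_card => y; rewrite !inE andbC.
Qed.

(** A walk may leave along [x] when [x] is one of the other half-edges at the
    vertex that the last pair of the history has led to. *)
Definition continues h x : bool := if h is p :: _ then siblings p.2 x else false.

Lemma card_continues h : (#|continues h| <= d.-1)%N.
Proof.
case: h => [|p h]; last by rewrite card_siblings.
by rewrite (eq_card0 (A := continues [::])).
Qed.

(** Counted from the beginning of the history, [x] being the current half-edge;
    it is the base point of a loop that begins after [m] steps. *)
Definition departure m h x : H := nth x (rcons (rev [seq p.1 | p <- h]) x) m.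

(** The steps of a nonbacktracking loop of length [k] whose last edge is fresh.
    The loop begins after [m] steps, which allows for a second loop explored after
    a first one, with a half-edge that [St] allows. *)
Definition loop_step (m k : nat) (St : seq (H * H) -> pred H) h x y : bool :=
  (if size h == m then St h x else continues h x) &&
  (((size h).+1 == (m + k)%N) ==>
     ((x \notin halves h) && siblings (departure m h x) y)).

Lemma history_head G w x0 i h : (0 < i < size w)%N ->
  continues (history G (take i w) ++ h) (nth x0 w i) =
  nb G (nth x0 w i.-1) (nth x0 w i).
Proof.
case: i => // i /andP[_ iw].
rewrite (take_nth x0) 1?ltnW // history_rcons /= /siblings /nb /= eq_sym.
by congr (_ && ~~ _); rewrite eq_sym.
Qed.

Lemma departures_history G w h :
  rev [seq p.1 | p <- history G w ++ h] = rev [seq p.1 | p <- h] ++ w.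
Proof. by rewrite map_cat rev_cat -map_comp map_id revK. Qed.

Lemma departure_start G w x0 i h : (i < size w)%N ->
  departure (size h) (history G (take i w) ++ h) (nth x0 w i) = nth x0 w 0.
Proof.
move=> iw; rewrite /departure departures_history rcons_cat nth_cat.
rewrite size_rev size_map ltnn subnn -take_nth //.
rewrite nth_take //; apply: set_nth_default; exact: leq_ltn_trans iw.
Qed.

Lemma halves_cat h1 h2 : halves (h1 ++ h2) =i halves h1 ++ halves h2.
Proof.
by move=> z; rewrite /halves !map_cat !mem_cat; do 4!case: (_ \in _).
Qed.

Lemma halves_history G w : halves (history G w) =i w ++ map (val G) w.
Proof.
move=> z; rewrite /halves -!map_comp map_id !mem_cat mem_rev; congr (_ || _).
by rewrite map_rev mem_rev.
Qed.

Lemma traj_loop G k St h w x0 : (0 < k)%N -> size w = k -> cycle (nb G) w ->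
  St h (nth x0 w 0) ->
  nth x0 w k.-1 \notin halves (history G (take k.-1 w) ++ h) ->
  traj G (loop_step (size h) k St) h w.
Proof.
move=> k0 sw /(cycle_nthP _ _ x0) cw Sw lw; apply/(trajP _ _ _ _ x0) => i iw.
rewrite /loop_step size_cat size_history size_takel 1?ltnW //; apply/andP; split.
  case: (posnP i) => [->|i0]; first by rewrite eqxx take0.
  rewrite -{2}[size h]add0n eqn_add2r gtn_eqF // history_head ?i0 //.
  have := cw i.-1; rewrite prednK // modn_small //; apply.
  exact: ltnW.
rewrite -addSn addnC eqn_add2l; apply/implyP => /eqP ik.
have iE : i = k.-1 by rewrite -ik.
rewrite {1 2}iE lw departure_start //=.
have := cw i iw; rewrite sw ik modnn /nb /siblings /=.
by rewrite -[X in _ -> _ && (X != _)]/(val G (nth x0 w i)).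
Qed.

(** The last half-edge is at a vertex met for the first time, where the only
    half-edge already used is the one of arrival. *)
Lemma uniq_last_fresh G w x0 : w != [::] -> sorted (nb G) w ->
  uniq [seq x.1 | x <- w] ->
  nth x0 w (size w).-1 \notin halves (history G (take (size w).-1 w)).
Proof.
move=> w0 /(sortedP x0) nw uw.
have sw : ((size w).-1 < size w)%N by rewrite ltn_predL lt0n size_eq0.
rewrite halves_history mem_cat; apply/norP; split.
  apply/negP => /(nthP x0)[i]; rewrite size_takel ?(ltnW sw) // => il.
  rewrite nth_take // => /(congr1 fst) e.
  have := @nth_uniq _ x0.1 [seq x.1 | x <- w] i (size w).-1.
  rewrite size_map !(nth_map x0) ?(ltn_trans il) // e eqxx => /(_ isT sw uw).
  by move/esym/eqP => ii; rewrite ii ltnn in il.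
apply/negP => /mapP[z /(nthP x0)[i]]; rewrite size_takel ?(ltnW sw) // => il.
rewrite nth_take // => <-{z} e.
have iw : (i.+1 < size w)%N by rewrite -ltn_predRL.
have := nw i iw; case/andP=> /eqP e1; rewrite -e; case/negP.
apply/eqP; apply: (uniq_map_inj uw); rewrite ?mem_nth //.
by rewrite e -e1.
Qed.

Lemma cycle_sorted (T : Type) (e : rel T) (w : seq T) : cycle e w -> sorted e w.
Proof. by case: w => //= x p; rewrite rcons_path => /andP[]. Qed.

Lemma simple_last_fresh G k (w : k.-tuple H) x0 : (0 < k)%N -> w \in simple_words G k ->
  nth x0 w k.-1 \notin halves (history G (take k.-1 w)).
Proof.
move=> k0; rewrite !inE => /andP[/cycle_sorted cw uw].
have := @uniq_last_fresh G w x0; rewrite -size_eq0 size_tuple -lt0n; exact.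
Qed.

Variable R : realFieldType.
Local Notation prob := (@prob d n R).
Local Notation Ex := (@Ex d n R).
Hypothesis nd_even : ~~ odd (n * d).

(** Each step offers [d - 1] choices, and closing the loop with a fresh edge means
    landing on one of the [d - 1] siblings of the base point. *)
Lemma loop_step_weight (m k M a : nat) St h : (0 < k)%N ->
  (size h < M)%N -> (2 * M < n * d)%N -> (size h = m -> (#|St h| <= a)%N) ->
  \sum_x \sum_(y | loop_step m k St h x y) prob ((x, y) :: h) <=
  ((if size h == m then a else d.-1)%:R *
   (if (size h).+1 == (m + k)%N then d.-1%:R / ((n * d)%:R - (2 * M)%:R) else 1))
   * prob h.
Proof.
move=> k0 hM MN ca.
have N0 : 0 < (n * d)%:R - (2 * M)%:R :> R by rewrite subr_gt0 ltr_nat.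
apply: (@weight_choice d n R (loop_step m k St) (fun x => if size h == m then St h x else continues h x)
  (fun x y => ((size h).+1 == (m + k)%N) ==>
     ((x \notin halves h) && siblings (departure m h x) y)) _ _ h).
- by [].
- by case: eqP => [/ca|_] //; apply: card_continues.
- by case: ifP => // _; rewrite divr_ge0 // ltW.
move=> x _; case: ifP => _; last exact: weight_any.
case: (boolP (x \in halves h)) => xh.
  by rewrite big_pred0 // mulr_ge0 ?prob_ge0 // divr_ge0 // ltW.
by apply: weight_fresh => //; rewrite card_siblings.
Qed.

Lemma prod_loop_weights (m k a : nat) (c : R) : (0 < k)%N ->
  \prod_(m <= i < m + k) ((if i == m then a else d.-1)%:R *
      (if i.+1 == (m + k)%N then c else 1)) = a%:R * d.-1%:R ^+ k.-1 * c.
Proof.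
case: k => // k _; rewrite big_split /= addnS; congr (_ * _).
  rewrite big_ltn ?ltnS ?leq_addr // eqxx; congr (_ * _).
  rewrite big_nat_cond (eq_bigr (fun=> d.-1%:R)); last first.
    by move=> i /andP[/andP[mi _] _]; rewrite gtn_eqF.
  by rewrite -big_nat_cond prodr_const_nat subSS addKn.
rewrite big_nat_recr ?leq_addr //= eqxx big_nat_cond big1 ?mul1r //.
by move=> i /andP[/andP[_ im] _]; rewrite eqSS ltn_eqF.
Qed.

Lemma Ex_simple_words_ub k : (0 < k)%N -> (2 * k < n * d)%N -> (0 < d)%N ->
  Ex (fun G => #|simple_words G k|%:R) <=
  (n * d)%:R * d.-1%:R ^+ k / ((n * d)%:R - (2 * k)%:R).
Proof.
move=> k0 kN d0.
have N0 : 0 < (n * d)%:R - (2 * k)%:R :> R by rewrite subr_gt0 ltr_nat.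
pose b (i : nat) : R := (if i == 0%N then (n * d)%N else d.-1)%:R *
   (if i.+1 == k then d.-1%:R / ((n * d)%:R - (2 * k)%:R) else 1).
apply: (@le_trans _ _ (\prod_(i < k) b i)); last first.
  have := @prod_loop_weights 0 k (n * d) (d.-1%:R / ((n * d)%:R - (2 * k)%:R)) k0.
  rewrite add0n big_mkord => ->; rewrite mulrA ler_wpM2r ?invr_ge0 ?(ltW N0) //.
  by rewrite -mulrA -exprSr prednK.
apply: le_trans (ntraj_ub0 (s := loop_step 0 k (fun _ => predT)) nd_even _ _).
- apply: Ex_le => G; rewrite -sum1_card natr_sum big_mkcond /=.
  apply: ler_sum => w _; case: ifP => [|_]; last by rewrite ler0n.
  move=> sw; have cw : cycle (nb G) w by move: sw; rewrite !inE => /andP[].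
  have [x0 _] := tuple_inhabited w k0.
  rewrite (@traj_loop _ _ _ [::] _ x0) ?size_tuple // cats0.
  exact: simple_last_fresh.
- by move=> i; rewrite mulr_ge0 //; case: ifP => // _; rewrite divr_ge0 // ltW.
- move=> h hk; apply: (loop_step_weight k0 hk kN) => _.
  by rewrite -card_half_edge max_card.
Qed.

End SimpleWords.

(** * Simple loops: second moment *)

Section SecondMoment.
Variables (d n : nat).
Local Notation H := (half_edge d n).
Implicit Types (G : graph d n) (h : seq (H * H)) (x y z : H).
Implicit Types St : seq (H * H) -> pred H.

Lemma eq_traj G s1 s2 h w :
  (forall h' x y, (size h <= size h' < size h + size w)%N -> s1 h' x y = s2 h' x y) ->
  traj G s1 h w = traj G s2 h w.
Proof.
elim: w h => [|x w IH] h //= e; rewrite e ?leqnn ?addnS ?ltnS ?leq_addr //.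
congr (_ && _); apply: IH => h' y z /andP[h1 h2]; apply: e.
by rewrite ltnW //= -addSnnS.
Qed.

Definition pair_step k St h x y : bool :=
  if (size h < k)%N then loop_step 0 k (fun=> predT) h x y
  else loop_step k k St h x y.

Lemma traj_pair G k St (w1 w2 : k.-tuple H) :
  traj G (pair_step k St) [::] (w1 ++ w2) =
  traj G (loop_step 0 k (fun=> predT)) [::] w1 &&
  traj G (loop_step k k St) (history G w1) w2.
Proof.
rewrite traj_cat cats0; congr (_ && _); apply: eq_traj => h x y.
  by rewrite /= add0n size_tuple /pair_step => ->.
rewrite size_history !size_tuple /pair_step => /andP[kh _].
by rewrite ltnNge kh.
Qed.

(** A nonbacktracking walk along the edges of a simple loop is determined by its
    first step: each vertex carries only two of the half-edges involved. *)
Lemma simple_same_edges G k (w : k.-tuple H) : (0 < k)%N -> w \in simple_words G k ->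
  (#|[set v in closed_words G k | all (mem (halves (history G w))) v]| <= 2 * k)%N.
Proof.
move=> k0; rewrite inE => /andP[cw uw].
set U := halves _; have UE := halves_history G w.
have uw' : uniq [seq x.1 | x <- map (val G) w].
  by have := simple_walkE k0 cw; rewrite uw /simple_walk -map_comp.
have UG x : x \in U -> val G x \in U.
  rewrite !UE !mem_cat => /orP[xw|/mapP[z zw ->]]; last by rewrite matchK zw.
  by rewrite map_f ?orbT.
have two x y z : x \in U -> y \in U -> z \in U -> x.1 = y.1 -> x.1 = z.1 ->
    x != y -> x != z -> y = z.
  rewrite !UE !mem_cat => xU yU zU xy xz nxy nxz.
  have yz : y.1 = z.1 by rewrite -xy xz.
  have I1 a b : a \in tval w -> b \in tval w -> a.1 = b.1 -> a = b.
    exact: (uniq_map_inj uw).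
  have I2 a b : a \in map (val G) w -> b \in map (val G) w -> a.1 = b.1 -> a = b.
    exact: (uniq_map_inj uw').
  case/orP: xU => xU; case/orP: yU => yU; case/orP: zU => zU;
    first [exact: I1 | exact: I2 | by rewrite (I1 x y) // eqxx in nxy
      | by rewrite (I2 x y) // eqxx in nxy | by rewrite (I1 x z) // eqxx in nxz
      | by rewrite (I2 x z) // eqxx in nxz].
have [x0 _] := tuple_inhabited w k0.
rewrite -(card_in_imset (f := fun v : k.-tuple H => nth x0 v 0)); last first.
  move=> u v; rewrite !inE => /andP[/(cycle_nthP _ _ x0) cu /allP uU].
  move=> /andP[/(cycle_nthP _ _ x0) cv /allP vU] e0.
  apply: val_inj; apply: (@eq_from_nth _ x0); rewrite ?size_tuple //.
  elim=> [|i IH] ik //; have ik' := ltnW ik.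
  have := cu i; have := cv i; rewrite !size_tuple modn_small // -IH //.
  move=> /(_ ik')/andP[/eqP e1 n1] /(_ ik')/andP[/eqP e2 n2].
  apply: (two (val G (nth x0 u i))) => //.
  - by apply/UG/uU/mem_nth; rewrite size_tuple.
  - by apply/uU/mem_nth; rewrite size_tuple.
  - by apply/vU/mem_nth; rewrite size_tuple.
have -> : (2 * k = size U)%N by rewrite size_halves size_history size_tuple.
apply: leq_trans (card_size _); apply: subset_leq_card.
apply/subsetP => z /imsetP[v]; rewrite !inE => /andP[_ /allP vU] ->.
by apply/vU/mem_nth; rewrite size_tuple.
Qed.

Definition loop_count G k St h : nat :=
  #|[set v : k.-tuple H | traj G (loop_step k k St) h v]|.

(** A second loop either ends with an edge off [w], or runs along [w] only, or can
    be rotated so as to begin on [w] and to end with an edge off [w]. The rotation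
    costs a factor [k], but the second loop then begins with one of [2 * k]
    half-edges only, and it still closes with a fresh edge. *)
Lemma simple_pairs_le G k (w : k.-tuple H) : (0 < k)%N -> w \in simple_words G k ->
  (#|simple_words G k| <= loop_count G k (fun=> predT) (history G w) +
     k * loop_count G k (fun h => mem (halves h)) (history G w) + 2 * k)%N.
Proof.
move=> k0 sw; set h := history G w; set U := halves h.
have sh : size h = k by rewrite size_history size_tuple.
have [x0 _] := tuple_inhabited w k0.
pose rt r (v : k.-tuple H) := [tuple of rot r v].
have rt_inj r : injective (rt r) by move=> u v /(congr1 val) /rot_inj /val_inj.
have loop_traj St (v : k.-tuple H) : v \in simple_words G k -> St h (nth x0 v 0) ->
    nth x0 v k.-1 \notin U -> traj G (loop_step k k St) h v.
  rewrite !inE => /andP[cv uv] Sv lv; rewrite -{1}sh.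
  apply: (traj_loop (x0 := x0)); rewrite ?size_tuple //.
  rewrite halves_cat mem_cat negb_or lv andbT.
  by apply: simple_last_fresh; rewrite // !inE cv.
have simple_rt r v : rt r v \in simple_words G k = (v \in simple_words G k).
  by rewrite !inE /= rot_cycle map_rot rot_uniq.
pose St h : pred H := mem (halves h).
pose B := [set v : k.-tuple H | traj G (loop_step k k St) h v].
have card_rt r : #|rt r @^-1: B| = loop_count G k St h.
  by apply: on_card_preimset; apply: onW_bij; apply: injF_bij.
have cover : simple_words G k \subset
    [set v : k.-tuple H | traj G (loop_step k k (fun=> predT)) h v]
    :|: (\bigcup_(r < k) rt r @^-1: B)
    :|: [set v in closed_words G k | all (mem U) v].
  apply/subsetP => v sv; rewrite !inE -orbA.
  have cv : cycle (nb G) v by move: sv; rewrite !inE => /andP[].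
  rewrite cv /=; case: (boolP (nth x0 v k.-1 \in U)) => [lv|lv]; last first.
    by rewrite (loop_traj (fun=> predT)).
  case: (boolP (all _ _)) => [|/allPn[z zv zU]]; rewrite ?orbT // orbF.
  apply/orP; right; apply/bigcupP.
  (* The last step off [w]. *)
  have [i [ik1 iU i1U]] : exists i, [/\ (i.+1 < k)%N, nth x0 v i \notin U
      & nth x0 v i.+1 \in U].
    have /nthP-/(_ x0)[j] := zv; rewrite size_tuple => jk zE.
    rewrite -zE in zU; clear z zv zE.
    elim: (k - j)%N {-2}j (leqnn (k - j)) jk zU => [|m IH] {}j; first by lia.
    move=> jm jk jU; case: (ltnP j.+1 k) => [j1k|kj]; last first.
      by case/negP: jU; have <- : k.-1 = j by lia.
    case: (boolP (nth x0 v j.+1 \in U)) => j1U; first by exists j.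
    by apply: (IH j.+1) => //; lia.
  exists (Ordinal ik1) => //; rewrite !inE; apply: loop_traj.
  - by rewrite simple_rt.
  - by rewrite /= nth_cat size_drop size_tuple subn_gt0 ik1 nth_drop addn0.
  rewrite /= nth_cat size_drop size_tuple ltnNge.
  have -> /= : (k - i.+1 <= k.-1)%N by lia.
  by have -> : (k.-1 - (k - i.+1) = i)%N by [lia]; rewrite nth_take.
apply: leq_trans (subset_leq_card cover) _.
apply: leq_trans (leq_card_setU _ _) _; rewrite leq_add ?simple_same_edges //.
apply: leq_trans (leq_card_setU _ _) _; rewrite leq_add2l.
apply: (@leq_trans (\sum_(r < k) #|rt r @^-1: B|)).
  elim/big_rec2: _ => [|r m A _ IH]; first by rewrite cards0.
  by apply: leq_trans (leq_card_setU _ _) _; rewrite leq_add2l.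
by rewrite (eq_bigr (fun=> loop_count G k St h)) ?sum_nat_const ?card_ord.
Qed.

Variable R : realFieldType.
Local Notation Ex := (@Ex d n R).
Hypothesis nd_even : ~~ odd (n * d).

Lemma Ex_pair_ub k St (a : nat) : (0 < k)%N -> (4 * k < n * d)%N -> (0 < d)%N ->
  (forall h, size h = k -> (#|St h| <= a)%N) ->
  Ex (fun G => \sum_(w in simple_words G k) (loop_count G k St (history G w))%:R) <=
  (n * d)%:R * d.-1%:R ^+ k / ((n * d)%:R - (4 * k)%:R) *
  (a%:R * d.-1%:R ^+ k / ((n * d)%:R - (4 * k)%:R)).
Proof.
move=> k0 kN d0 ca.
have kN2 : (2 * (2 * k) < n * d)%N by lia.
have e4 : (4 * k)%N = (2 * (2 * k))%N by lia.
have N0 : 0 < (n * d)%:R - (4 * k)%:R :> R by rewrite subr_gt0 ltr_nat.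
set c : R := d.-1%:R / ((n * d)%:R - (4 * k)%:R).
have c0 : 0 <= c by rewrite divr_ge0 // ltW.
pose b (i : nat) : R :=
  if (i < k)%N then (if i == 0%N then (n * d)%N else d.-1)%:R * (if i.+1 == k then c else 1)
  else (if i == k then a else d.-1)%:R * (if i.+1 == (k + k)%N then c else 1).
apply: (@le_trans _ _ (\prod_(i < k + k) b i)); last first.
  rewrite -(big_mkord predT b) (big_cat_nat (leq0n k) (leq_addr k k)) /=.
  have := @prod_loop_weights d R 0 k (n * d) c k0; rewrite add0n => e1.
  have e2 := @prod_loop_weights d R k k a c k0.
  rewrite (eq_big_nat _ _ (F2 := fun i => (if i == 0%N then (n * d)%N else d.-1)%:R *
    (if i.+1 == k then c else 1))); last by move=> i /andP[_ ik]; rewrite /b ik.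
  rewrite e1 [X in _ * X](eq_big_nat _ _ (F2 := fun i => (if i == k then a else d.-1)%:R *
    (if i.+1 == (k + k)%N then c else 1))); last first.
    by move=> i /andP[ki _]; rewrite /b ltnNge ki.
  rewrite e2 /c le_eqVlt; apply/orP; left; apply/eqP.
  have -> : d.-1%:R ^+ k = d.-1%:R ^+ k.-1 * d.-1%:R :> R by rewrite -exprSr prednK.
  by move: (_^-1) => u; ring.
apply: le_trans (ntraj_ub0 (s := pair_step k St) nd_even _ _).
- apply: Ex_le => G; rewrite /ntraj.
  rewrite (big_tuple_cat k k (fun w => (traj G (pair_step k St) [::] w)%:R)) /=.
  rewrite [leLHS]big_mkcond /=; apply: ler_sum => w _; case: ifPn => sw; last first.
    by apply: sumr_ge0 => v _; rewrite ler0n.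
  rewrite /loop_count -sum1_card natr_sum big_mkcond /=; apply: ler_sum => v _.
  rewrite inE traj_pair; case: ifP => _; last by rewrite ler0n.
  suff -> : traj G (loop_step 0 k (fun=> predT)) [::] w by [].
  move: sw; rewrite !inE => /andP[cw uw].
  have [x0 _] := tuple_inhabited w k0.
  rewrite (traj_loop (h := [::]) (x0 := x0)) ?size_tuple // cats0.
  by apply: simple_last_fresh; rewrite // !inE cw.
- by move=> i; rewrite /b; case: ifP => _; rewrite mulr_ge0 //; case: ifP.
move=> h hk; rewrite /pair_step /b /c e4; case: ifP => hk1.
  apply: (loop_step_weight R (m := 0)) => //; first by rewrite mul2n -addnn.
  by move=> _; rewrite -card_half_edge max_card.
apply: (loop_step_weight R) => //; first by rewrite mul2n -addnn.
exact: ca.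
Qed.

(** The main term is the square of the bound on the mean; the two others come from
    the pairs of loops that share an edge. *)
Lemma Ex_simple_words_sq k (D b : R) :
  (0 < k)%N -> (4 * k < n * d)%N -> (0 < d)%N ->
  D = (n * d)%:R - (4 * k)%:R -> b = (n * d)%:R * d.-1%:R ^+ k / D ->
  Ex (fun G => #|simple_words G k|%:R ^+ 2) <=
  b * b + k%:R * (b * ((2 * k)%:R * d.-1%:R ^+ k / D)) + (2 * k)%:R * b.
Proof.
move=> k0 kN d0 DE bE.
have D0 : 0 < D by rewrite DE subr_gt0 ltr_nat.
pose cA G w := (loop_count G k (fun=> predT) (history G w))%:R : R.
pose cB G w := (loop_count G k (fun h => mem (halves h)) (history G w))%:R : R.
apply: (@le_trans _ _ (Ex (fun G => \sum_(w in simple_words G k) cA G w +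
  k%:R * \sum_(w in simple_words G k) cB G w + (2 * k)%:R * #|simple_words G k|%:R))).
  apply: Ex_le => G; rewrite expr2 [leLHS]mulr_natl [X in _ + X]mulr_natr.
  rewrite -[leLHS]sumr_const -[X in _ + X]sumr_const mulr_sumr -!big_split /=.
  apply: ler_sum => w sw; rewrite /cA /cB -!natrM -!natrD ler_nat.
  exact: simple_pairs_le.
rewrite !ExD !ExZ; apply: lerD; first apply: lerD.
- rewrite bE DE; apply: Ex_pair_ub => // h _.
  by rewrite -card_half_edge max_card.
- rewrite ler_wpM2l // bE DE; apply: Ex_pair_ub => // h <-.
  by rewrite -size_halves card_size.
rewrite ler_wpM2l //; apply: le_trans (Ex_simple_words_ub _ _ _ _ _) _ => //; first lia.
rewrite bE DE ler_wpM2l ?mulr_ge0 ?exprn_ge0 // lef_pV2 ?posrE //.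
  by rewrite lerB // ler_nat; lia.
  by rewrite subr_gt0 ltr_nat; lia.
by rewrite -DE.
Qed.

End SecondMoment.

(** * Simple loops: lower bound on the mean *)

Section LowerBound.
Variables (d n : nat).
Local Notation H := (half_edge d n).
Implicit Types (G : graph d n) (h : seq (H * H)) (x y z : H).

Definition visited h x : seq 'I_n := x.1 :: [seq p.1.1 | p <- h].

Lemma departure0_cons p h x : departure 0 (p :: h) x = departure 0 h p.1.
Proof.
by rewrite /departure /= rev_cons; case: (rev _).
Qed.

Lemma departure0_visited h x : (departure 0 h x).1 \in visited h x.
Proof.
have : departure 0 h x \in rcons (rev [seq p.1 | p <- h]) x.
  by rewrite mem_nth // size_rcons.
rewrite mem_rcons !inE mem_rev => /predU1P[->|]; first by rewrite eqxx.
by move=> /mapP[p ph ->]; rewrite (map_f (fun p => p.1.1)) ?orbT.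
Qed.

Definition may_leave h x : bool := (h == [::]) || continues h x.

(** Landing on new vertices only keeps every step fresh, so that the weight of each
    pair is bounded from below. *)
Definition simple_step k h x y : bool :=
  may_leave h x && (if (size h).+1 == k then siblings (departure 0 h x) y
                    else y.1 \notin visited h x).

(** The current vertex is new, the earlier edges lead to visited vertices, and the
    siblings of the base point are still unmatched, so that the loop can close. *)
Definition simple_so_far h : Prop :=
  if h is p :: h' then
    [/\ p.2.1 \notin visited h' p.1,
        {in h', forall q, q.2.1 \in visited h' p.1} &
        forall z, siblings (departure 0 h' p.1) z -> z \notin halves h]
  else True.

Lemma simple_so_far_fresh h x : simple_so_far h -> may_leave h x ->
  [/\ x \notin halves h, {in halves h, forall z, z.1 \in visited h x} &
      forall z, siblings (departure 0 h x) z -> (z \notin halves h) && (z != x)].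
Proof.
case: h => [_ _|p h [pv hv sv] /= /andP[/eqP xp xp2]].
  by split=> // z /andP[_ zx]; rewrite /halves /=.
have xh : x.1 \notin visited h p.1 by rewrite xp.
have vh q : q \in p :: h -> q.1.1 \in visited h p.1.
  by move=> qh; apply: (map_f (fun q : H * H => q.1.1) qh).
split.
- apply/negP; rewrite mem_cat => /orP[] /mapP[q qh e].
    by case/negP: xh; rewrite e vh.
  move: qh; rewrite inE => /predU1P[qp|qh]; first by rewrite e qp eqxx in xp2.
  by case/negP: xh; rewrite e hv.
- move=> z; rewrite mem_cat => /orP[] /mapP[q qh ->]; rewrite inE; apply/orP.
    by right; apply: vh.
  move: qh; rewrite inE => /predU1P[->|qh]; first by left; rewrite xp.
  by right; apply: hv.
move=> z; rewrite departure0_cons => sz; rewrite sv //=.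
apply: contraNneq xh => <-; case/andP: sz => /eqP -> _.
exact: departure0_visited.
Qed.

Lemma simple_so_far_step h x y : simple_so_far h -> may_leave h x ->
  y.1 \notin visited h x -> simple_so_far ((x, y) :: h).
Proof.
move=> Ih lx yv; have [xh hv sv] := simple_so_far_fresh Ih lx.
split=> //= [q qh|z sz].
  by apply: hv; rewrite mem_cat map_f ?orbT.
rewrite -[_ :: h]cat1s (halves_cat [:: (x, y)] h) mem_cat !inE /= !negb_or.
have /andP[-> ->] := sv z sz; rewrite /= andbT.
apply: contraNneq yv => <-; case/andP: sz => /eqP -> _.
exact: departure0_visited.
Qed.

Lemma traj_simple G k (w : k.-tuple H) : (0 < k)%N ->
  traj G (simple_step k) [::] w -> w \in simple_words G k.
Proof.
move=> k0.
have [x0 _] := tuple_inhabited w k0.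
move/(trajP _ _ _ _ x0) => tw.
have sw := size_tuple w.
have step i : (i.+1 < k)%N -> nb G (nth x0 w i) (nth x0 w i.+1).
  move=> ik; have /andP[+ _] := tw i.+1 (leq_trans ik (eq_leq (esym sw))).
  rewrite /may_leave history_head ?sw // => /orP[|//].
  by rewrite cats0 -size_eq0 size_history size_takel // sw ltnW.
have st i : (i < k)%N -> size (history G (take i w) ++ [::]) = i.
  by move=> ik; rewrite cats0 size_history size_takel // sw ltnW.
rewrite !inE; apply/andP; split.
  apply/(cycle_nthP _ _ x0) => i; rewrite sw leq_eqVlt => /orP[/eqP ik|ik].
    have ik' : (i < k)%N by rewrite ik.
    have /andP[_] := tw i (leq_trans ik' (eq_leq (esym sw))).
    rewrite st // ik eqxx (@departure_start _ _ _ w x0 i [::]) ?sw //.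
    by rewrite modnn /nb /siblings.
  by rewrite modn_small //; apply: step.
suff uw i : (i <= k)%N -> uniq [seq x.1 | x <- take i w].
  by rewrite -[tval w]take_size sw uw.
elim: i => [|i IH] ik; first by rewrite take0.
rewrite (take_nth x0) ?sw // map_rcons rcons_uniq IH ?(ltnW ik) // andbT.
case: i ik {IH} => [|i] ik; first by rewrite take0.
have /andP[_] := tw i (leq_trans (ltnW ik) (eq_leq (esym sw))).
rewrite st 1?ltnW // ltn_eqF //.
have /andP[/eqP <- _] := step i ik.
apply: contra => /mapP[z zw ->]; move: zw; rewrite (take_nth x0) ?sw 1?ltnW //.
rewrite mem_rcons !inE => /predU1P[->|zw]; first by rewrite eqxx.
by rewrite cats0 -map_comp (map_f (fun u : H => u.1)) ?mem_rev ?orbT.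
Qed.

Variable R : realFieldType.
Local Notation prob := (@prob d n R).
Local Notation Ex := (@Ex d n R).
Hypothesis nd_even : ~~ odd (n * d).

Lemma card_unvisited h x :
  ((n - (size h).+1) * d <= #|[pred y : H | y.1 \notin visited h x]|)%N.
Proof.
pose A : {set 'I_n} := [set v | v \notin visited h x].
have -> : #|[pred y : H | y.1 \notin visited h x]| = (#|A| * d)%N.
  transitivity #|setX A [set: 'I_d]|; last by rewrite cardsX cardsT card_ord.
  by apply: eq_card => -[v i]; rewrite !inE /= andbT.
rewrite leq_mul2r; apply/orP; right.
have nE : (#|A| + #|~: A| = n)%N by rewrite cardsC card_ord.
suff : (#|~: A| <= (size h).+1)%N by move: nE; lia.
have : (#|visited h x| <= (size h).+1)%N.
  by apply: leq_trans (card_size _) _; rewrite /= size_map.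
apply: leq_trans; apply: subset_leq_card; apply/subsetP => v.
by rewrite !inE negbK.
Qed.

Lemma simple_step_weight k h : (0 < n * d)%N -> (size h < k)%N -> simple_so_far h ->
  (if size h == 0 then (n * d)%N else d.-1)%:R *
  ((if (size h).+1 == k then d.-1 else ((n - (size h).+1) * d)%N)%:R / (n * d)%:R)
  * prob h <=
  \sum_x \sum_(y | simple_step k h x y) prob ((x, y) :: h).
Proof.
move=> N0 hk Ih.
have N0' : 0 < (n * d)%:R :> R by rewrite ltr0n.
pose c := (if (size h).+1 == k then d.-1 else ((n - (size h).+1) * d)%N).
apply: (@le_trans _ _ (\sum_(x | may_leave h x) (c%:R / (n * d)%:R * prob h))).
  have c0 : 0 <= c%:R / (n * d)%:R * prob h.
    by apply: mulr_ge0 (prob_ge0 _ _); rewrite divr_ge0.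
  rewrite sumr_const -[leRHS]mulr_natl -[leLHS]mulrA ler_wpM2r //.
  rewrite ler_nat; case: h {hk Ih c c0} => [|p h] /=; last by rewrite card_siblings.
  by rewrite -card_half_edge subset_leq_card //; apply/subsetP.
rewrite big_mkcond /=; apply: ler_sum => x _; case: ifPn => lx; last first.
  by apply: sumr_ge0 => y _; apply: prob_ge0.
have [xh hv sv] := simple_so_far_fresh Ih lx.
apply: (@le_trans _ _ (\sum_(y | simple_step k h x y) (prob h / (n * d)%:R))).
  rewrite sumr_const -[leRHS]mulr_natl mulrAC -[leLHS]mulrA.
  have p0 : 0 <= prob h / (n * d)%:R by rewrite divr_ge0 ?prob_ge0.
  rewrite ler_wpM2r // ler_nat /c /simple_step lx /=.
  case: ifP => _; first by rewrite card_siblings.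
  exact: card_unvisited.
apply: ler_sum => y /andP[_ sy]; rewrite ler_pdivrMr // mulrC.
apply: prob_cons_lb => //; rewrite /free; move: sy; case: ifP => _; first exact: sv.
move=> yv; apply/andP; split; first by apply: contra yv => /hv.
by apply: contraNneq yv => ->; rewrite inE eqxx.
Qed.

Lemma Ex_simple_words_lb k : (0 < k)%N -> (0 < n * d)%N ->
  d.-1%:R ^+ k * \prod_(1 <= i < k) ((n - i)%:R / n%:R) <=
  Ex (fun G => #|simple_words G k|%:R).
Proof.
move=> k0 N0.
pose b (i : nat) : R := (if i == 0 then (n * d)%N else d.-1)%:R *
  ((if i.+1 == k then d.-1 else ((n - i.+1) * d)%N)%:R / (n * d)%:R).
have nd0 : (n * d)%:R != 0 :> R by rewrite pnatr_eq0 -lt0n.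
apply: (@le_trans _ _ (\prod_(i < k) b i)).
  case: k k0 @b => // k _ b.
  have -> : \prod_(i < k.+1) b i =
      (n * d)%:R * d.-1%:R ^+ k * (\prod_(i < k) ((n - i.+1)%:R / n%:R) *
      (d.-1%:R / (n * d)%:R)).
    rewrite /b big_split /= big_ord_recl /=.
    rewrite (eq_bigr (fun=> d.-1%:R)) // prodr_const card_ord; congr (_ * _).
    rewrite big_ord_recr /= eqxx; congr (_ * _); apply: eq_bigr => i _.
    rewrite eqSS ltn_eqF // !natrM; move: nd0; rewrite natrM mulf_eq0 negb_or.
    by move=> /andP[n0 d0]; field; rewrite n0 d0.
  rewrite big_add1 /= big_mkord exprSr le_eqVlt; apply/orP; left; apply/eqP.
  by move: (\prod_(_ < _) _) (n * d)%:R nd0 => P N N0'; field.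
apply: (@le_trans _ _ (Ex (fun G => ntraj R G (simple_step k) [::] k))); last first.
  apply: Ex_le => G; rewrite -sum1_card natr_sum big_mkcond /=.
  apply: ler_sum => w _; case: (boolP (traj _ _ _ _)) => [/(traj_simple k0) -> //|_].
  by case: ifP; rewrite ?ler01.
apply: (@ntraj_lb0 _ _ _ _ (fun h => (size h < k)%N -> simple_so_far h)) => //.
- by move=> i; rewrite /b mulr_ge0 ?divr_ge0.
- move=> h x y Ih /andP[lx yP] hk; have hk' := ltnW hk.
  apply: simple_so_far_step (Ih hk') lx _.
  by move: yP; rewrite ltn_eqF.
by move=> h Ih hk; apply: simple_step_weight (Ih hk).
Qed.

End LowerBound.

(** * Words that are neither simple nor powers *)

Section Tangled.
Variables (d n : nat).
Local Notation H := (half_edge d n).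
Implicit Types (G : graph d n) (h : seq (H * H)) (x y z : H).

(** A fresh edge closes a cycle of the explored graph. *)
Definition collision h x y : bool := (x \notin halves h) && (y.1 \in visited h x).

Definition tangled_step (t1 t2 : nat) h x y : bool :=
  may_leave h x && ((size h == t1) || (size h == t2) ==> collision h x y).

Section OneWord.
Variables (G : graph d n) (k : nat) (w : seq H) (x0 : H).
Hypotheses (k_gt0 : (0 < k)%N) (size_w : size w = k).
Hypothesis cycle_w : cycle (nb G) w.
Local Notation W i := (nth x0 w i).

Let nbW i : (i < k)%N -> nb G (W i) (W (i.+1 %% k)).
Proof. by rewrite -size_w; move: i; apply/cycle_nthP. Qed.

Let nbS i : (i.+1 < k)%N -> nb G (W i) (W i.+1).
Proof. by move=> ik; have := nbW (ltnW ik); rewrite modn_small. Qed.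

Let fresh j := W j \notin halves (history G (take j w)).
Let lands j := (val G (W j)).1 \in visited (history G (take j w)) (W j).

Let mem_taken j x : (j <= k)%N -> reflect (exists2 i, (i < j)%N & x = W i) (x \in take j w).
Proof.
move=> jk; apply: (iffP (nthP x0)); rewrite size_takel ?size_w // => -[i ij].
  by rewrite nth_take // => <-; exists i.
by move=> ->; exists i; rewrite ?nth_take.
Qed.

Let freshP j : (j < k)%N ->
  reflect (forall i, (i < j)%N -> W j <> W i /\ W j <> val G (W i)) (fresh j).
Proof.
move=> jk; have jk' := ltnW jk; rewrite /fresh halves_history mem_cat.
apply: (iffP norP) => [[/(mem_taken _ jk') n1 n2] i ij|nj].
  split=> e; first by apply: n1; exists i.
  by case/mapP: n2; exists (W i) => //; apply/mem_taken => //; exists i.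
split; first by apply/(mem_taken _ jk') => -[i /nj[]].
by apply/mapP => -[x /(mem_taken _ jk')[i ij ->]] e; case: (nj i ij).
Qed.

Let landsP j : (j < k)%N ->
  reflect (exists2 i, (i <= j)%N & (val G (W j)).1 = (W i).1) (lands j).
Proof.
move=> jk; rewrite /lands /visited -map_comp inE.
apply: (iffP predU1P) => [[e|/mapP[x]]|[i]].
- by exists j.
- rewrite mem_rev => /(mem_taken _ (ltnW jk))[i ij ->] e.
  by exists i; rewrite // ltnW.
rewrite leq_eqVlt => /predU1P[->|ij] e; [by left|right].
apply/mapP; exists (W i) => //; rewrite mem_rev.
by apply/(mem_taken _ (ltnW jk)); exists i.
Qed.

Let lands_last : lands k.-1.
Proof.
have lk : (k.-1 < k)%N by rewrite prednK.
apply/(landsP lk); exists 0%N => //.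
by have := nbW lk; rewrite prednK // modnn => /andP[/eqP ->].
Qed.

Section OneCollision.
Variable t : nat.
Hypothesis tk : (t.+1 < k)%N.
Hypothesis before : forall j, (j < t)%N -> ~~ lands j.
Hypothesis after : forall j, (t < j < k)%N -> ~~ (fresh j && lands j).

Let distinct i j : (i < j <= t)%N -> (W i).1 <> (W j).1.
Proof.
case: j => // j /andP[ij jt] e.
have jk : (j.+1 < k)%N by lia.
case/negP: (before jt); apply/(landsP (ltnW jk)); exists i => //.
by have /andP[/eqP -> _] := nbS jk.
Qed.

Let vertex_inj i j : (i <= t)%N -> (j <= t)%N -> (W i).1 = (W j).1 -> i = j.
Proof.
move=> it jt e; case: (ltngtP i j) => // ij.
  by case: (@distinct i j); rewrite ?ij.
by case: (@distinct j i); rewrite ?ij.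
Qed.

(* A fresh step reaches a new vertex, from which every step is fresh again; the
   walk would not come back to its starting vertex. *)
Let stale j : (t < j < k)%N -> ~~ fresh j.
Proof.
elim: (k - j)%N {-2}j (leqnn (k - j)%N) => [|m IH] {}j jm /andP[tj jk]; first by lia.
apply/negP => fj; have := @after j; rewrite tj jk fj => /(_ isT) /= nl.
case: (ltnP j.+1 k) => [j1k|kj]; last first.
  by case/negP: nl; have -> : j = k.-1 by lia.
have nbj := nbS j1k.
have : ~~ fresh j.+1 by apply: IH; lia.
case/negP; apply/(freshP j1k) => i; rewrite ltnS => ij.
have /andP[/eqP e ne] := nbj.
split=> e2; first by case/negP: nl; apply/(landsP jk); exists i; rewrite ?e ?e2.
move: ij; rewrite leq_eqVlt => /predU1P[ij|ij].
  by rewrite e2 ij eqxx in ne.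
case/negP: nl; apply/(landsP jk); exists i.+1 => //; rewrite e e2.
by have /andP[/eqP -> _] := nbS (leq_ltn_trans ij jk).
Qed.

Let old x := exists2 i, (i <= t)%N & x = W i \/ x = val G (W i).

Let all_old j : (j < k)%N -> old (W j).
Proof.
elim/ltn_ind: j => j IH jk; case: (leqP j t) => [jt|tj]; first by exists j; [|left].
have := @stale j; rewrite tj jk => /(_ isT) /(freshP jk) nf.
have [i ij e] : exists2 i, (i < j)%N & W j = W i \/ W j = val G (W i).
  case: (boolP [exists i : 'I_j, (W j == W i) || (W j == val G (W i))]).
    by move=> /existsP[i /orP[]/eqP e]; exists i => //; [left|right].
  rewrite negb_exists => /forallP ne; case: nf => i ij.
  by have := ne (Ordinal ij); rewrite negb_or => /andP[/eqP ? /eqP ?].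
have [l lt el] := IH i ij (ltn_trans ij jk); exists l => //.
by case: e el => -> [] ->; rewrite ?matchK; auto.
Qed.

(* The last edge is old and arrives at the starting vertex by a half-edge other
   than the first one; only the edge of the collision does so. *)
Let closes : (val G (W t)).1 = (W 0).1 /\ W k.-1 = W t.
Proof.
have lk : (k.-1 < k)%N by rewrite prednK.
have := nbW lk; rewrite prednK // modnn => /andP[/eqP e ne].
have [l lt [el|el]] := all_old lk; last first.
- have l0 : l = 0%N by apply: vertex_inj; rewrite // -e el matchK.
  by rewrite el matchK l0 eqxx in ne.
move: lt; rewrite leq_eqVlt => /predU1P[lt|lt]; first by rewrite -lt -el.
have lk1 : (l.+1 < k)%N by lia.
have /andP[/eqP e1 _] := nbS lk1.
by have := @vertex_inj l.+1 0 lt isT; rewrite -e1 -el e => /(_ erefl).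
Qed.

Let next_vertex i : (i <= t)%N -> (val G (W i)).1 = (W (i.+1 %% t.+1)).1.
Proof.
rewrite leq_eqVlt => /predU1P[->|it].
  by rewrite modnn; case: closes.
rewrite modn_small //; have ik : (i.+1 < k)%N by lia.
by have /andP[/eqP -> _] := nbS ik.
Qed.

Let periodic j : (j < k)%N -> W j = W (j %% t.+1).
Proof.
elim: j => [|j IH] jk; first by rewrite mod0n.
have jt : (j %% t.+1 <= t)%N by rewrite -ltnS ltn_mod.
have j1t : (j.+1 %% t.+1 <= t)%N by rewrite -ltnS ltn_mod.
have mE : ((j %% t.+1).+1 %% t.+1 = j.+1 %% t.+1)%N by rewrite -addn1 modnDml addn1.
have /andP[/eqP e ne] := nbS jk; rewrite IH 1?ltnW // in e ne.
rewrite next_vertex // mE in e.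
have [l lt [el|el]] := all_old jk.
  by rewrite el; congr (W _); apply: vertex_inj; rewrite // e el.
exfalso; have := next_vertex lt; rewrite -el -e => /(vertex_inj j1t).
have l1t : (l.+1 %% t.+1 <= t)%N by rewrite -ltnS ltn_mod.
move=> /(_ l1t) e2; case/eqP: ne; rewrite el; congr (val G (W _)).
have : j %% t.+1 + 1 = l + 1 %[mod t.+1] by rewrite modnDml !addn1.
by move/eqP; rewrite eqn_modDr modn_mod => /eqP ->; rewrite modn_small.
Qed.

(** After the collision all steps are old. The last one then forces the collision
    to have taken place at the starting vertex, so that the edges known form a
    simple cycle around which the walk can only turn. *)
Lemma one_collision_power : proper_power w.
Proof.
have lk : (k.-1 < k)%N by rewrite prednK.
apply: (@periodic_power _ _ x0 t.+1); rewrite size_w.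
- by rewrite tk.
- have [_ e] := closes; have := periodic lk; rewrite e => e2.
  have : t = (k.-1 %% t.+1)%N.
    by apply: vertex_inj; rewrite -?e2 // -ltnS ltn_mod.
  by move=> e3; rewrite /dvdn -(prednK k_gt0) -addn1 -modnDml -e3 addn1 modnn.
exact: periodic.
Qed.

End OneCollision.

(** The first return to a visited vertex is a collision; the second collision
    exists by the lemma above. *)
Lemma tangled_collisions :
  ~~ uniq [seq x.1 | x <- w] -> ~~ proper_power w ->
  exists t1 t2, (t1 < t2 < k)%N /\ traj G (tangled_step t1 t2) [::] w.
Proof.
move=> nu np.
have [t lt tmin] := ex_minnP (ex_intro (fun j => lands j) _ lands_last).
have before j : (j < t)%N -> ~~ lands j.
  by move=> jt; apply/negP => /tmin; rewrite leqNgt jt.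
have tk' : (t < k)%N by rewrite (leq_ltn_trans (tmin _ lands_last)) // prednK.
have dist i j : (i < j)%N -> (j <= t)%N -> (W i).1 <> (W j).1.
  case: j => // j ij jt e; have jk : (j.+1 < k)%N by lia.
  case/negP: (before j jt); apply/(landsP (ltnW jk)); exists i => //.
  by have /andP[/eqP -> _] := nbS jk.
have utake : uniq [seq x.1 | x <- take t.+1 w].
  apply/(uniqP (W 0).1) => i j; rewrite !inE size_map size_takel ?size_w // => it jt.
  rewrite !(nth_map x0) ?size_takel ?size_w // !nth_take // => e.
  case: (ltngtP i j) => // ij; first by case: (dist i j).
  by case: (dist j i).
have tk : (t.+1 < k)%N.
  rewrite ltn_neqAle tk' andbT; apply: contra nu => /eqP e.
  by rewrite -[w]take_size size_w -e.
have ft : fresh t.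
  have := @uniq_last_fresh _ _ G (take t.+1 w) x0.
  rewrite -size_eq0 size_takel ?size_w 1?ltnW //= take_takel // nth_take //; apply=> //.
  have := cycle_sorted cycle_w; rewrite -{1}(cat_take_drop t.+1 w).
  by case: (take _ _) => //= x p; rewrite cat_path => /andP[].
case: (boolP [exists j : 'I_k, (t < j)%N && (fresh j && lands j)]) => [|none].
  case/existsP => -[j jk] /= /andP[tj cj]; exists t, j; rewrite tj jk; split => //.
  apply/(trajP _ _ _ _ x0) => i; rewrite size_w => ik; rewrite /tangled_step cats0.
  rewrite size_history size_takel ?size_w 1?ltnW //; apply/andP; split.
    case: (posnP i) => [->|i0]; first by rewrite take0.
    have := @history_head _ _ G w x0 i [::]; rewrite size_w i0 ik cats0 => /(_ isT) e.
    apply/orP; right; rewrite e; have := @nbS i.-1.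
    by rewrite prednK //; apply.
  apply/implyP => /orP[] /eqP ->; last exact: cj.
  by rewrite /collision -/(fresh t) ft.
case/negP: np; apply: (@one_collision_power t) => // j /andP[tj jk].
by move: none; rewrite negb_exists => /forallP/(_ (Ordinal jk)); rewrite /= tj.
Qed.

End OneWord.

Variable R : realFieldType.
Local Notation prob := (@prob d n R).
Local Notation Ex := (@Ex d n R).
Hypothesis nd_even : ~~ odd (n * d).

Lemma tangled_step_weight (t1 t2 k : nat) h :
  (size h < k)%N -> (2 * k < n * d)%N ->
  \sum_x \sum_(y | tangled_step t1 t2 h x y) prob ((x, y) :: h) <=
  ((if size h == 0%N then (n * d)%N else d.-1)%:R *
   (if (size h == t1) || (size h == t2)
    then (d * k)%:R / ((n * d)%:R - (2 * k)%:R) else 1)) * prob h.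
Proof.
move=> hk kN.
have N0 : 0 < (n * d)%:R - (2 * k)%:R :> R by rewrite subr_gt0 ltr_nat.
apply: (@weight_choice d n R (tangled_step t1 t2) (may_leave h)
  (fun x y => (size h == t1) || (size h == t2) ==> collision h x y) _ _ h).
- by [].
- case: h {hk} => [|p h] /=; last exact: card_continues.
  by rewrite -card_half_edge max_card.
- by case: ifP => // _; rewrite divr_ge0 // ltW.
move=> x _; case: ifP => _; last exact: weight_any.
case: (boolP (x \in halves h)) => xh.
  rewrite big_pred0; last by move=> y; rewrite /collision xh.
  by apply: mulr_ge0 (prob_ge0 _ _); rewrite divr_ge0 // ltW.
apply: (@le_trans _ _ (\sum_(y : H | y.1 \in visited h x) prob ((x, y) :: h))).
  by rewrite le_eqVlt; apply/orP; left; apply/eqP; apply: eq_bigl => y; rewrite /collision xh.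
apply: weight_fresh => //.
pose A : {set 'I_n} := [set v | v \in visited h x].
apply: (@leq_trans #|setX A [set: 'I_d]|).
  by apply: subset_leq_card; apply/subsetP => -[v i]; rewrite !inE /= andbT.
rewrite cardsX cardsT card_ord mulnC leq_mul2l; apply/orP; right.
apply: (@leq_trans (size (visited h x))); last by rewrite /= size_map.
apply: leq_trans (card_size _); apply: subset_leq_card.
by apply/subsetP => v; rewrite !inE.
Qed.

Lemma prod_tangled_weights (t1 t2 k : nat) (a b c : R) :
  (t1 < t2 < k)%N ->
  \prod_(i < k) ((if i == 0%N :> nat then a else b) *
     (if (i == t1 :> nat) || (i == t2 :> nat) then c else 1)) = a * b ^+ k.-1 * c ^+ 2.
Proof.
move=> /andP[t12 t2k]; have t1k := ltn_trans t12 t2k.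
rewrite big_split /=; congr (_ * _).
  case: k t1k {t2k} => // k _; rewrite big_ord_recl /=.
  by rewrite (eq_bigr (fun=> b)) // prodr_const card_ord.
rewrite (bigD1 (Ordinal t1k)) //= eqxx (bigD1 (Ordinal t2k)) /=; last first.
  by rewrite -val_eqE /= gtn_eqF.
rewrite eqxx orbT big1 ?mulr1 // => i /andP[].
by rewrite -!val_eqE /= => /negbTE -> /negbTE ->.
Qed.

(** A word that is neither simple nor a power closes two cycles with fresh
    edges, which costs two factors of order [k / n]. *)
Lemma Ex_tangled_ub k : (0 < k)%N -> (2 * k < n * d)%N ->
  Ex (fun G => #|tangled_words G k|%:R) <=
  (k ^ 2)%:R * ((n * d)%:R * d.-1%:R ^+ k.-1 *
    ((d * k)%:R / ((n * d)%:R - (2 * k)%:R)) ^+ 2).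
Proof.
move=> k0 kN.
have N0 : 0 < (n * d)%:R - (2 * k)%:R :> R by rewrite subr_gt0 ltr_nat.
set B := _ * _ ^+ 2.
have B0 : 0 <= B.
  apply: mulr_ge0; first by rewrite mulr_ge0 ?exprn_ge0.
  by rewrite exprn_ge0 // divr_ge0 // ltW.
apply: (@le_trans _ _ (\sum_(t2 < k) \sum_(t1 < k | (t1 < t2)%N)
    Ex (fun G => ntraj R G (tangled_step t1 t2) [::] k))); last first.
  apply: (@le_trans _ _ (\sum_(t2 < k) \sum_(t1 < k) B)); last first.
    by rewrite !sumr_const !card_ord -mulrnA mulr_natl.
  apply: ler_sum => t2 _; rewrite [leLHS]big_mkcond; apply: ler_sum => t1 _ /=.
  case: ifP => // t12.
  rewrite /B -(@prod_tangled_weights t1 t2) ?t12 ?ltn_ord //.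
  apply: (@ntraj_ub0 d n R (tangled_step t1 t2) (fun i => (if i == 0%N then
    (n * d)%:R else d.-1%:R) * (if (i == t1) || (i == t2) then
    (d * k)%:R / ((n * d)%:R - (2 * k)%:R) else 1))) => //.
    move=> i; rewrite mulr_ge0 //; first by case: ifP.
    by case: ifP => // _; rewrite divr_ge0 // ltW.
  move=> h hk; apply: le_trans (tangled_step_weight t1 t2 hk kN) _.
  by case: (size h == 0%N).
have pt G : #|tangled_words G k|%:R <=
    \sum_(t2 < k) \sum_(t1 < k | (t1 < t2)%N) ntraj R G (tangled_step t1 t2) [::] k.
  rewrite -sum1_card natr_sum big_mkcond /= /ntraj.
  under [leRHS]eq_bigr do rewrite exchange_big /=.
  rewrite exchange_big /=; apply: ler_sum => w _.
  have S0 (P : 'I_k -> 'I_k -> bool) (F : 'I_k -> 'I_k -> bool) :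
    0 <= \sum_i \sum_(j | P i j) (F i j)%:R :> R.
    by apply: sumr_ge0 => i _; apply: sumr_ge0 => j _; rewrite ler0n.
  case: ifP => [|_]; last exact: S0.
  rewrite !inE => /and3P[cw uw pw].
  have [x0 _] := tuple_inhabited w k0.
  have [t1 [t2 [/andP[t12 t2k] tw]]] := tangled_collisions x0 k0 (size_tuple w) cw uw pw.
  have t1k := ltn_trans t12 t2k.
  rewrite (bigD1 (Ordinal t2k)) //= (bigD1 (Ordinal t1k)) //= tw -addrA lerDl addr_ge0 //.
    by apply: sumr_ge0 => j _; rewrite ler0n.
  by apply: sumr_ge0 => i _; apply: sumr_ge0 => j _; rewrite ler0n.
apply: (@le_trans _ _ (Ex (fun G => \sum_(t2 < k) \sum_(t1 < k | (t1 < t2)%N)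
  ntraj R G (tangled_step t1 t2) [::] k))); first exact: Ex_le.
by rewrite Ex_sum; apply: ler_sum => t2 _; rewrite Ex_sum.
Qed.

End Tangled.

(** * The transition matrix of the nonbacktracking walk *)

Section Frobenius.
Variables (R : realFieldType) (m : nat).
Implicit Types A B : 'M[R]_m.

(** The square of the Frobenius norm. *)
Definition frob A : R := \tr (A *m A^T).

Lemma frobE A : frob A = \sum_i \sum_j A i j ^+ 2.
Proof.
apply: eq_bigr => i _; rewrite mxE; apply: eq_bigr => j _.
by rewrite mxE expr2.
Qed.

Lemma mxtrace_mul_le A B : \tr (A *m B) <= (frob A + frob B) / 2.
Proof.
rewrite ler_pdivlMr // mulr_natr mulr2n.
have -> : frob B = \sum_i \sum_j B j i ^+ 2 by rewrite frobE exchange_big.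
rewrite frobE -!big_split /=; apply: ler_sum => i _; rewrite mxE -!big_split /=.
apply: ler_sum => j _; have := sqr_ge0 (A i j - B j i); nra.
Qed.

End Frobenius.

Section NonbacktrackingMatrix.
Variables (d n : nat) (R : realFieldType) (G : graph d n).
Local Notation H := (half_edge d n).
Local Notation N := #|{: H}|.
Hypothesis d_ge2 : (1 < d)%N.

Let q : R := d.-1%:R^-1.
Let q_neq0 : d.-1%:R != 0 :> R.
Proof. by rewrite pnatr_eq0; case: d d_ge2 => [|[]]. Qed.

Definition vertex_mx : 'M[R]_N :=
  \matrix_(i, j) ((enum_val i).1 == (enum_val j).1)%:R.
Definition match_mx : 'M[R]_N :=
  \matrix_(i, j) (val G (enum_val i) == enum_val j)%:R.
Definition turn_mx : 'M[R]_N := q *: (vertex_mx - 1%:M).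
(** One step crosses an edge, then turns to a uniform sibling. *)
Definition walk_mx : 'M[R]_N := match_mx *m turn_mx.
Definition unif_mx : 'M[R]_N := const_mx N%:R^-1.

Local Notation B := vertex_mx.
Local Notation Pi := match_mx.
Local Notation S := turn_mx.
Local Notation P := walk_mx.
Local Notation J := unif_mx.

Lemma sum_enum_val (V : nmodType) (F : H -> V) :
  \sum_(i < N) F (enum_val i) = \sum_x F x.
Proof. by rewrite -(big_enum_val (fun x => F x)); apply: eq_bigl. Qed.

Lemma vertex_mx_sqr : B *m B = d%:R *: B.
Proof.
apply/matrixP => i j; rewrite !mxE.
under eq_bigr do rewrite !mxE -natrM mulnb.
rewrite (sum_enum_val (fun z => ((((enum_val i).1 == z.1) && (z.1 == (enum_val j).1))%:R : R))).
rewrite -natrM -natr_sum; congr (_%:R).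
case: eqP => [e|ne]; last first.
  by rewrite muln0 big1 // => z _; case: eqP => // e; rewrite -e; case: eqP.
rewrite muln1 -[RHS](card_vertex_half_edges d (enum_val i).1) -sum1_card [RHS]big_mkcond /=.
by apply: eq_bigr => z _; rewrite !inE -e eq_sym andbb; case: eqP.
Qed.

Lemma match_mx_sqr : Pi *m Pi = 1%:M.
Proof.
apply/matrixP => i j; rewrite !mxE.
rewrite (bigD1 (enum_rank (val G (enum_val i)))) //= !mxE enum_rankK eqxx mul1r.
rewrite matchK (inj_eq enum_val_inj) big1 ?addr0 // => l li; rewrite !mxE.
case: eqP => [e|]; last by rewrite mul0r.
by case/eqP: li; rewrite e enum_valK.
Qed.

Lemma match_mx_sym : Pi^T = Pi.
Proof. by apply/matrixP => i j; rewrite !mxE match_swap. Qed.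

Lemma turn_mx_sym : S^T = S.
Proof. by apply/matrixP => i j; rewrite !mxE [(enum_val i).1 == _]eq_sym [i == j]eq_sym.
Qed.

Lemma turn_mx_sqr : S *m S = q%:M + (1 - q) *: S.
Proof.
rewrite /turn_mx -scalemxAl -scalemxAr mulmxBl mulmxBr mul1mx !mulmx1 vertex_mx_sqr.
have dE : d%:R = d.-1%:R + 1 :> R by rewrite natr1 prednK // ltnW.
have qE : d.-1%:R = q^-1 by rewrite /q invrK.
have q0 : q != 0 by rewrite invr_eq0.
apply/matrixP => i j; rewrite !mxE dE qE; case: (i == j); rewrite /= ?mulr1n ?mulr0n.
  by field.
by field.
Qed.

Lemma walk_mx_tr : P^T = S *m Pi.
Proof. by rewrite /walk_mx trmx_mul turn_mx_sym match_mx_sym. Qed.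

(** Time reversal: reading a walk backwards exchanges the ends of its edges. *)
Lemma walk_mx_pow_tr a : (P ^+ a)^T = Pi *m (P ^+ a) *m Pi.
Proof.
elim: a => [|a IH]; first by rewrite expr0 -idmxE trmx1 mulmx1 match_mx_sqr.
by rewrite {1}exprS exprSr -!mulmxE trmx_mul IH walk_mx_tr /walk_mx !mulmxA.
Qed.

Definition walk_frob a : R := frob (P ^+ a).
Definition walk_reverse a : R := \tr (P ^+ a.*2.+1 *m Pi).

Lemma walk_frob0 : walk_frob 0 = (n * d)%:R.
Proof. by rewrite /walk_frob /frob expr0 -idmxE trmx1 mulmx1 mxtrace1 card_half_edge. Qed.

Lemma walk_reverse0 : walk_reverse 0 = 0.
Proof.
rewrite /walk_reverse expr1 mxtrace_mulC mulmxA match_mx_sqr mul1mx.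
by apply: big1 => i _; rewrite !mxE !eqxx subrr mulr0.
Qed.

(** The relation [S * S = q + (1 - q) * S], which says that two turns at the
    same vertex amount to no turn or to one, reduces the squared norm of the
    powers of the transition matrix to traces of its even powers. *)
Lemma walk_frobS a :
  walk_frob a.+1 = q * walk_frob a + (1 - q) * walk_reverse a.
Proof.
rewrite /walk_frob /walk_reverse /frob !walk_mx_pow_tr.
have -> : P ^+ a.+1 *m (Pi *m P ^+ a.+1 *m Pi) =
    q *: (P ^+ a *m (Pi *m P ^+ a *m Pi)) + (1 - q) *: (P ^+ a.*2.+1 *m Pi).
  have -> : P ^+ a.*2.+1 = P ^+ a *m P *m P ^+ a by rewrite !mulmxE -exprSr -exprD addSn addnn.
  rewrite {1}exprSr {1}exprS -!mulmxE; move: (P ^+ a) => X.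
  rewrite /walk_mx -!mulmxA (mulmxA Pi Pi) match_mx_sqr mul1mx (mulmxA S S) turn_mx_sqr.
  by rewrite mulmxDl mul_scalar_mx !mulmxDr -scalemxAl -!scalemxAr.
by rewrite mxtraceD !mxtraceZ.
Qed.

Lemma walk_reverseS a :
  walk_reverse a.+1 = q * walk_reverse a + (1 - q) * \tr (P ^+ a.+1.*2).
Proof.
rewrite /walk_reverse doubleS exprS {1 2}exprSr -!mulmxE.
move: (P ^+ a.*2.+1) => X; rewrite /walk_mx -[LHS]mxtrace_mulC !mulmxA.
rewrite match_mx_sqr mul1mx -!mulmxA mxtrace_mulC -!mulmxA turn_mx_sqr.
by rewrite !mulmxDr mxtraceD mul_mx_scalar -!scalemxAr !mxtraceZ.
Qed.

Hypothesis n_gt0 : (0 < n)%N.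

Let N_neq0 : N%:R != 0 :> R.
Proof. by rewrite card_half_edge pnatr_eq0 muln_eq0 negb_or -!lt0n n_gt0 ltnW. Qed.

Lemma turn_mx_unif : S *m J = J.
Proof.
apply/matrixP => i j; rewrite !mxE.
under eq_bigr do rewrite !mxE.
rewrite -mulr_suml -mulr_sumr sumrB.
have -> : \sum_(l < N) ((enum_val i).1 == (enum_val l).1)%:R = d%:R :> R.
  rewrite (sum_enum_val (fun z => (((enum_val i).1 == z.1)%:R : R))) -natr_sum.
  congr (_%:R); rewrite -[RHS](card_vertex_half_edges d (enum_val i).1) -sum1_card.
  by rewrite [RHS]big_mkcond /=; apply: eq_bigr => z _; rewrite !inE eq_sym; case: eqP.
have -> : \sum_(l < N) (i == l)%:R = 1 :> R.
  by rewrite (bigD1 i) //= eqxx big1 ?addr0 // => l; rewrite eq_sym => /negbTE ->.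
have -> : d%:R - 1 = d.-1%:R :> R by rewrite -[X in X%:R - _](prednK (ltnW d_ge2)) -natr1 addrK.
by rewrite /q mulVf ?mul1r.
Qed.

Lemma match_mx_unif : Pi *m J = J.
Proof.
apply/matrixP => i j; rewrite !mxE.
rewrite (bigD1 (enum_rank (val G (enum_val i)))) //= !mxE enum_rankK eqxx mul1r.
rewrite big1 ?addr0 // => l li; rewrite !mxE; case: eqP => [e|]; last by rewrite mul0r.
by case/eqP: li; rewrite e enum_valK.
Qed.

Lemma unif_mx_sym : J^T = J.
Proof. by apply/matrixP => i j; rewrite !mxE. Qed.

Lemma walk_mx_unif : P *m J = J.
Proof. by rewrite /walk_mx -mulmxA turn_mx_unif match_mx_unif. Qed.

Lemma unif_walk_mx : J *m P = J.
Proof.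
rewrite -[LHS]trmxK trmx_mul walk_mx_tr unif_mx_sym -mulmxA.
by rewrite match_mx_unif turn_mx_unif unif_mx_sym.
Qed.

Lemma walk_pow_unif a : P ^+ a *m J = J.
Proof.
elim: a => [|a IH]; first by rewrite expr0 -idmxE mul1mx.
by rewrite exprSr -mulmxE -mulmxA walk_mx_unif.
Qed.

Lemma unif_walk_pow a : J *m P ^+ a = J.
Proof.
elim: a => [|a IH]; first by rewrite expr0 -idmxE mulmx1.
by rewrite exprS -mulmxE mulmxA unif_walk_mx.
Qed.

Lemma unif_mx_sqr : J *m J = J.
Proof.
apply/matrixP => i j; rewrite !mxE.
under eq_bigr do rewrite !mxE.
by rewrite sumr_const card_ord -[_ *+ _]mulr_natl mulrA mulfV // mul1r.
Qed.

Lemma mxtrace_unif : \tr J = 1.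
Proof.
rewrite /mxtrace; under eq_bigr do rewrite mxE.
by rewrite sumr_const card_ord -[_ *+ _]mulr_natl mulfV.
Qed.

(** The part of the walk orthogonal to the constants, whose trace and squared
    norm are those of the walk up to the contribution 1 of the constants. *)
Definition walk_dev a : 'M[R]_N := P ^+ a - J.

Lemma walk_devD a b : walk_dev a *m walk_dev b = walk_dev (a + b).
Proof.
rewrite /walk_dev mulmxBl !mulmxBr walk_pow_unif unif_walk_pow unif_mx_sqr subrr.
by rewrite subr0 mulmxE -exprD.
Qed.

Lemma walk_devS a : walk_dev a.+1 = walk_dev a *m P.
Proof. by rewrite /walk_dev mulmxBl unif_walk_mx exprSr. Qed.

Lemma frob_walk_dev a : frob (walk_dev a) = walk_frob a - 1.
Proof.
rewrite /frob /walk_dev linearB /= unif_mx_sym mulmxBl !mulmxBr.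
rewrite -[J *m (P ^+ a)^T]trmxK trmx_mul trmxK unif_mx_sym walk_pow_unif unif_mx_sym.
by rewrite unif_mx_sqr subrr subr0 linearB /= mxtrace_unif.
Qed.

Lemma q_ge0 : 0 <= q. Proof. by rewrite invr_ge0. Qed.

Lemma q_le1 : q <= 1.
Proof.
rewrite invf_le1 ?ltr0n; last by rewrite -ltnS prednK // ltnW.
by rewrite ler1n -ltnS prednK // ltnW.
Qed.

Lemma turn_mx_ge0 i j : 0 <= S i j.
Proof.
rewrite !mxE mulr_ge0 ?q_ge0 // subr_ge0 ler_nat.
by case: (eqVneq i j) => [->|_]; rewrite ?eqxx.
Qed.

(** The transition matrix is doubly stochastic, hence contracting. *)
Lemma frob_mul_walk A : frob (A *m P) <= frob A.
Proof.
rewrite /frob trmx_mul walk_mx_tr /walk_mx !mulmxA.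
set C := A *m Pi; have frobC : \tr (C *m C^T) = \tr (A *m A^T).
  rewrite trmx_mul match_mx_sym -[_ *m (Pi *m _)]mulmxA (mulmxA Pi Pi).
  by rewrite match_mx_sqr mul1mx.
have -> : C *m S *m S *m Pi *m A^T = C *m (S *m S) *m C^T.
  by rewrite trmx_mul match_mx_sym !mulmxA.
rewrite turn_mx_sqr mulmxDr mulmxDl mxtraceD mul_mx_scalar -scalemxAl -scalemxAr.
rewrite -scalemxAl !mxtraceZ frobC.
suff le : \tr (C *m S *m C^T) <= \tr (C *m C^T).
  rewrite frobC in le; have q1 : 0 <= 1 - q by rewrite subr_ge0 q_le1.
  by have := ler_wpM2l q1 le; rewrite !mulrBl !mul1r; lra.
rewrite -[leRHS]/(frob C) frobE; apply: ler_sum => i _.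
clearbody C; rewrite mxE.
under eq_bigr do rewrite [(C *m S) _ _]mxE [C^T _ _]mxE mulr_suml.
have rowS j : \sum_l S j l = 1.
  have := congr1 (fun M : 'M[R]_N => M j j) turn_mx_unif; rewrite mxE.
  under eq_bigr do rewrite [J _ _]mxE; rewrite -mulr_suml [J _ _]mxE.
  by move=> /(canRL (mulfVK N_neq0)); rewrite mulVf.
have colS l : \sum_j S j l = 1.
  by rewrite -[RHS](rowS l); apply: eq_bigr => j _; rewrite -{1}turn_mx_sym mxE.
apply: (@le_trans _ _ (\sum_j \sum_l (S l j * (C i l ^+ 2 / 2) + S l j * (C i j ^+ 2 / 2)))).
  apply: ler_sum => j _; apply: ler_sum => l _.
  have := sqr_ge0 (C i l - C i j); have := turn_mx_ge0 l j; nra.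
under eq_bigr do rewrite big_split /=.
rewrite big_split /= exchange_big /=.
under eq_bigr do rewrite -mulr_suml rowS mul1r.
under [X in _ + X]eq_bigr do rewrite -mulr_suml colS mul1r.
by rewrite -big_split /= le_eqVlt; apply/orP; left; apply/eqP; apply: eq_bigr => j _; field.
Qed.

Lemma frob_walk_dev_mono a b : (a <= b)%N -> frob (walk_dev b) <= frob (walk_dev a).
Proof.
move=> /subnK <-; elim: (b - a)%N => // c IH.
by rewrite addSn walk_devS; apply: le_trans (frob_mul_walk _) IH.
Qed.

(** Splitting [k] steps into [a] and [k - a] of them, both at least [a], bounds the
    trace by a squared norm that does not depend on [k]. *)
Lemma mxtrace_walk_le a k : (2 * a <= k)%N -> \tr (P ^+ k) <= walk_frob a.
Proof.
move=> ak; have -> : \tr (P ^+ k) = \tr (walk_dev k) + 1.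
  by rewrite /walk_dev linearB /= mxtrace_unif subrK.
rewrite -lerBrDr -frob_walk_dev -[k](@subnKC a); last lia.
rewrite -walk_devD; apply: le_trans (mxtrace_mul_le _ _) _.
rewrite ler_pdivrMr // mulr_natr mulr2n lerD2l.
by apply: frob_walk_dev_mono; lia.
Qed.

Lemma walk_mxE i j : P i j = q * (nb G (enum_val i) (enum_val j))%:R.
Proof.
rewrite !mxE (bigD1 (enum_rank (val G (enum_val i)))) //= big1 ?addr0 => [|l li].
  rewrite !mxE enum_rankK eqxx mul1r; congr (q * _).
  rewrite /nb -(inj_eq enum_val_inj) enum_rankK.
  case: (eqVneq (val G (enum_val i)) (enum_val j)) => [->|ne].
    by rewrite eqxx subrr.
  by rewrite subr0 andbT.
rewrite !mxE; case: eqP => [e|]; last by rewrite mul0r.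
by case/eqP: li; rewrite e enum_valK.
Qed.

Lemma walk_powE m i j : (P ^+ m) i j = q ^+ m *
  \sum_(v : m.-tuple H) (path (nb G) (enum_val i) v &&
                         (last (enum_val i) v == enum_val j))%:R.
Proof.
elim: m i => [|m IH] i.
  rewrite expr0 -idmxE mxE mul1r (big_pred1 [tuple]) /=.
    by rewrite (inj_eq enum_val_inj).
  by move=> w; apply/esym/eqP; apply: tuple0.
rewrite exprS -mulmxE mxE (big_tuple_cons (fun v => (path (nb G) (enum_val i) v &&
   (last (enum_val i) v == enum_val j))%:R)) mulr_sumr /=.
rewrite -(sum_enum_val (fun x => q ^+ m.+1 * _)); apply: eq_bigr => l _.
rewrite walk_mxE IH exprS -!mulrA; congr (q * _); rewrite mulrCA; congr (_ * _).
rewrite mulr_sumr; apply: eq_bigr => v _.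
by case: (nb _ _ _); rewrite ?mul1r ?mul0r.
Qed.

Lemma closed_words_trace k : (0 < k)%N ->
  #|closed_words G k|%:R = d.-1%:R ^+ k * \tr (P ^+ k).
Proof.
move=> k0; rewrite /mxtrace.
under eq_bigr do rewrite walk_powE.
rewrite -mulr_sumr mulrA -exprMn /q mulfV // expr1n mul1r.
rewrite (sum_enum_val (fun x => \sum_(v : k.-tuple H) ((path (nb G) x v && (last x v == x))%:R : R))).
rewrite exchange_big /= -sum1_card natr_sum big_mkcond /=; apply: eq_bigr => v _.
rewrite inE; case: (tval v) (size_tuple v) k0 => [<-//|x0 p _ _].
have -> := cycle_path x0 (nb G) (x0 :: p).
rewrite (bigD1 (last x0 p)) //= eqxx andbT big1 ?addr0; first by case: ifP.
by move=> x xl; rewrite eq_sym (negbTE xl) andbF.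
Qed.

Lemma closed_words_le_frob a k : (0 < k)%N -> (2 * a <= k)%N ->
  #|closed_words G k|%:R <= d.-1%:R ^+ k * walk_frob a.
Proof.
by move=> k0 ak; rewrite closed_words_trace // ler_wpM2l ?exprn_ge0 ?mxtrace_walk_le.
Qed.

End NonbacktrackingMatrix.

(** * Moments of the counts and probability of failure *)

Section Assembly.
Variables (d n : nat) (R : realFieldType).
Local Notation H := (half_edge d n).
Local Notation Ex := (@Ex d n R).
Local Notation N := ((n * d)%:R : R).
Local Notation q := (d.-1%:R^-1 : R).
Implicit Types G : graph d n.
Hypotheses (nd_even : ~~ odd (n * d)) (d_ge3 : (3 <= d)%N) (n_gt0 : (0 < n)%N).

Let d_gt0 : (0 < d)%N. Proof. exact: ltn_trans d_ge3. Qed.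
Let d_gt1 : (1 < d)%N. Proof. exact: ltn_trans d_ge3. Qed.
Let N_gt0 : 0 < N. Proof. by rewrite ltr0n muln_gt0 n_gt0. Qed.
Let e_ge2 : 2 <= d.-1%:R :> R. Proof. by rewrite ler_nat -ltnS prednK. Qed.
Let e_gt0 : 0 < d.-1%:R :> R. Proof. by apply: lt_le_trans e_ge2. Qed.
Let q_gt0 : 0 < q. Proof. by rewrite invr_gt0. Qed.

(** A proper power is determined by its root, which is at most half as long. *)
Lemma power_words_le G m : (0 < m)%N ->
  (#|[set w in closed_words G m | proper_power w]| <=
     \sum_(1 <= l < (m./2).+1) #|closed_words G l|)%N.
Proof.
move=> m0; rewrite big_add1 /= big_mkord.
case: (set_0Vmem [set w in closed_words G m | proper_power w]) => [->|[w0 _]].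
  by rewrite cards0.
pose f (l : 'I_(m./2)) (t : l.+1.-tuple H) : m.-tuple H :=
  insubd w0 (flatten (nseq (m %/ l.+1) (tval t))).
have sub : [set w in closed_words G m | proper_power w] \subset
    \bigcup_l (@f l @: closed_words G l.+1).
  apply/subsetP => w; rewrite !inE => /andP[cw /proper_powerP[t [a [wE /andP[t0 tm] a1]]]].
  have mE : m = (a * size t)%N by rewrite -(size_tuple w) wE size_flatten_nseq.
  have tl : ((size t).-1 < m./2)%N by rewrite prednK // mE; nia.
  have st : size t == (size t).-1.+1 by rewrite prednK.
  apply/bigcupP; exists (Ordinal tl) => //; apply/imsetP; exists (Tuple st).
    rewrite inE /=.
    by case: a wE a1 {mE} => // a wE _; move: cw; rewrite wE => /cycle_power.
  have md : (m %/ size t)%N = a by rewrite {1}mE mulnK.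
  by apply: val_inj; rewrite val_insubd /= prednK // md -wE size_tuple eqxx.
apply: leq_trans (subset_leq_card sub) _.
apply: (@leq_trans (\sum_(l < m./2) #|@f l @: closed_words G l.+1|)).
  elim/big_rec2: _ => [|l b A _ IH]; first by rewrite cards0.
  by apply: leq_trans (leq_card_setU _ _) _; rewrite leq_add2l.
by apply: leq_sum => l _; apply: leq_imset_card.
Qed.

Lemma closed_words_split G m : (0 < m)%N ->
  (#|closed_words G m| <= #|simple_words G m| + #|tangled_words G m| +
     \sum_(1 <= l < (m./2).+1) #|closed_words G l|)%N.
Proof.
move=> m0; apply: (@leq_trans (#|simple_words G m| + #|tangled_words G m| +
  #|[set w in closed_words G m | proper_power w]|)); last first.
  by rewrite leq_add2l power_words_le.
apply: leq_trans (leq_trans (leq_card_setU _ _) (leq_add (leq_card_setU _ _) (leqnn _))).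
apply: subset_leq_card; apply/subsetP => w; rewrite !inE => -> /=.
by case: (uniq _); case: (proper_power _).
Qed.

(** A geometric sum: there are at most [n * d * (d - 1) ^ j] closed walks of length
    [j], the squared norm for no step being [n * d]. *)
Lemma power_words_ub G l : (0 < l)%N ->
  \sum_(1 <= j < l.+1) #|closed_words G j|%:R <= 2 * N * d.-1%:R ^+ l :> R.
Proof.
move=> l0; apply: (@le_trans _ _ (\sum_(1 <= j < l.+1) N * d.-1%:R ^+ j)).
  rewrite !big_nat; apply: ler_sum => j /andP[j0 _].
  rewrite mulrC -(walk_frob0 R G).
  exact: closed_words_le_frob.
rewrite -mulr_sumr mulrAC [leRHS]mulrC ler_wpM2l ?(ltW N_gt0) //.
elim: l l0 => // -[|l] IH _; first by rewrite big_nat1; have := e_gt0; lra.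
rewrite big_nat_recr //= exprS.
have := IH isT; have := exprn_gt0 l.+1 e_gt0; have := e_ge2.
set E := d.-1%:R; set X := E ^+ l.+1; set S := \sum_(_ <= _ < _) _; nra.
Qed.

Lemma Ex_tangled_small k : (0 < k)%N -> (4 * k <= n * d)%N ->
  Ex (fun G => #|tangled_words G k|%:R) <=
  4 * d%:R ^+ 2 * k%:R ^+ 4 / N * d.-1%:R ^+ k.
Proof.
move=> k0 kN; have kN2 : (2 * k < n * d)%N by lia.
apply: le_trans (Ex_tangled_ub R nd_even k0 kN2) _.
have h : N / 2 <= N - (2 * k)%:R.
  have : (4 * k)%:R <= N by rewrite ler_nat.
  by rewrite (natrM _ 4 k) (natrM _ 2 k); lra.
have D0 : 0 < N - (2 * k)%:R by have := N_gt0; lra.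
have le1 : ((d * k)%:R / (N - (2 * k)%:R)) ^+ 2 <= (2 * (d%:R * k%:R) / N) ^+ 2.
  rewrite lerXn2r ?nnegrE ?divr_ge0 ?mulr_ge0 ?(ltW D0) ?(ltW N_gt0) //.
  rewrite ler_pdivrMr // natrM mulrAC ler_pdivlMr //.
  have := mulr_ge0 (ler0n R d) (ler0n R k); set u := _ * k%:R; have := N_gt0; nra.
have le2 : d.-1%:R ^+ k.-1 <= d.-1%:R ^+ k :> R.
  by rewrite ler_weXn2l ?leq_pred //; have := e_ge2; lra.
rewrite natrX; apply: (@le_trans _ _ (k%:R ^+ 2 * (N * d.-1%:R ^+ k * (2 * (d%:R * k%:R) / N) ^+ 2))).
  rewrite ler_wpM2l ?exprn_ge0 //; apply: ler_pM.
  - by rewrite mulr_ge0 ?exprn_ge0 ?(ltW N_gt0).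
  - by rewrite exprn_ge0 // divr_ge0 ?(ltW D0).
  - by rewrite ler_wpM2l ?(ltW N_gt0).
  - exact: le1.
rewrite le_eqVlt; apply/orP; left; apply/eqP.
by move: N N_gt0 => M M0; field; rewrite gt_eqF.
Qed.

(** The trace counts the closed words. The simple ones give the main term; the
    powers are too short to be many. *)
Lemma Ex_trace_even a l : (0 < l <= a)%N -> (8 * a <= n * d)%N ->
  Ex (fun G => \tr (walk_mx R G ^+ l.*2)) <=
  1 + 72 * d%:R ^+ 2 * a%:R ^+ 4 / N + 2 * N * q ^+ l.
Proof.
move=> /andP[l0 la] aN.
have m0 : (0 < l.*2)%N by rewrite double_gt0.
pose E : R := d.-1%:R.
have E0 : 0 < E ^+ l.*2 by rewrite exprn_gt0.
have trE G : \tr (walk_mx R G ^+ l.*2) = E ^- l.*2 * #|closed_words G l.*2|%:R.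
  by rewrite closed_words_trace // mulrA mulVf ?mul1r // gt_eqF.
apply: (@le_trans _ _ (Ex (fun G => E ^- l.*2 * (#|simple_words G l.*2|%:R +
    #|tangled_words G l.*2|%:R + 2 * N * E ^+ l)))).
  apply: Ex_le => G; rewrite trE ler_wpM2l ?invr_ge0 ?(ltW E0) //.
  apply: (@le_trans _ _ (#|simple_words G l.*2| + #|tangled_words G l.*2| +
     \sum_(1 <= j < l.+1) #|closed_words G j|)%N%:R).
    by rewrite ler_nat; have := closed_words_split G m0; rewrite doubleK.
  rewrite !natrD lerD2l natr_sum.
  exact: power_words_ub.
rewrite ExZ !ExD Ex_cst //.
have simple_ub : Ex (fun G => #|simple_words G l.*2|%:R) <= (1 + 8 * a%:R / N) * E ^+ l.*2.
  apply: le_trans (Ex_simple_words_ub R nd_even m0 _ d_gt0) _; first by lia.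
  rewrite mulrAC ler_wpM2r ?(ltW E0) //.
  have h : N / 2 <= N - (2 * l.*2)%:R.
    have : (8 * l)%:R <= N by rewrite ler_nat; lia.
    by rewrite -muln2 !natrM; lra.
  have D0 : 0 < N - (2 * l.*2)%:R by have := N_gt0; lra.
  rewrite ler_pdivrMr //.
  have la' : l%:R <= a%:R :> R by rewrite ler_nat.
  have -> : (2 * l.*2)%:R = 4 * l%:R :> R by rewrite -muln2 !natrM; ring.
  have h' : 4 * l%:R <= N / 2 by move: h; rewrite -muln2 !natrM; lra.
  have l0' : 0 <= l%:R :> R by [].
  rewrite -subr_ge0.
  have -> : (1 + 8 * a%:R / N) * (N - 4 * l%:R) - N =
     8 * a%:R - 4 * l%:R - 8 * a%:R * (4 * l%:R) / N.
    by move: N N_gt0 => M M0; field; rewrite gt_eqF.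
  have : 8 * a%:R * (4 * l%:R) / N <= 4 * a%:R.
    rewrite ler_pdivrMr //; have : 0 <= a%:R :> R by []; nra.
  by lra.
have tangled_ub : Ex (fun G => #|tangled_words G l.*2|%:R) <=
    64 * d%:R ^+ 2 * a%:R ^+ 4 / N * E ^+ l.*2.
  apply: le_trans (Ex_tangled_small m0 _) _; first by lia.
  rewrite ler_wpM2r ?(ltW E0) // ler_wpM2r ?invr_ge0 ?(ltW N_gt0) //.
  have -> : 64 * d%:R ^+ 2 * a%:R ^+ 4 = 4 * d%:R ^+ 2 * (2 * a%:R) ^+ 4 :> R by ring.
  rewrite ler_wpM2l ?mulr_ge0 ?exprn_ge0 // lerXn2r ?nnegrE ?mulr_ge0 //.
  by rewrite -natrM ler_nat; lia.
apply: (@le_trans _ _ (E ^- l.*2 * ((1 + 8 * a%:R / N) * E ^+ l.*2 +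
   64 * d%:R ^+ 2 * a%:R ^+ 4 / N * E ^+ l.*2 + 2 * N * E ^+ l))).
  by rewrite ler_wpM2l ?invr_ge0 ?(ltW E0) // lerD2r lerD.
have -> : E ^- l.*2 * ((1 + 8 * a%:R / N) * E ^+ l.*2 +
   64 * d%:R ^+ 2 * a%:R ^+ 4 / N * E ^+ l.*2 + 2 * N * E ^+ l) =
   1 + 8 * a%:R / N + 64 * d%:R ^+ 2 * a%:R ^+ 4 / N + 2 * N * q ^+ l.
  rewrite -/E exprVn -addnn exprD; have : E ^+ l != 0 by rewrite gt_eqF ?exprn_gt0.
  move: (E ^+ l) N N_gt0 => X M M0 X0.
  by field; rewrite X0 gt_eqF.
rewrite lerD2r -addrA lerD2l -mulrDl ler_wpM2r ?invr_ge0 ?(ltW N_gt0) //.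
have a1 : 1 <= a%:R :> R by rewrite ler1n (leq_trans l0).
have d1 : 1 <= d%:R :> R by rewrite ler1n.
have : 1 <= d%:R ^+ 2 :> R by rewrite exprn_ege1.
have : a%:R <= a%:R ^+ 4 :> R by rewrite ler_eXnr.
set D2 := _ ^+ 2; set A4 := _ ^+ 4; nra.
Qed.

(** The two linear recurrences have constants summing to 1, so that they keep the
    bound 1 + [A]; what starts away from it is damped by a factor [q] per step. *)
Lemma Ex_walk_frob_ub a : (8 * a <= n * d)%N -> (0 < a)%N ->
  Ex (fun G => walk_frob R G a) <=
  1 + 72 * d%:R ^+ 2 * a%:R ^+ 4 / N + N * (1 + 2 * a%:R ^+ 2 * d%:R) * q ^+ a.
Proof.
move=> aN a0; set A := 72 * _ * _ / N.
have A0 : 0 <= A by rewrite divr_ge0 ?(ltW N_gt0) // !mulr_ge0 ?exprn_ge0.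
have q1 : 0 <= 1 - q by rewrite subr_ge0 q_le1.
have q0 := ltW q_gt0.
have rev l : (l <= a)%N ->
    Ex (fun G => walk_reverse R G l) <= 1 + A + 2 * N * l%:R * q ^+ l.
  elim: l => [_|l IH la].
    rewrite (eq_Ex (g := fun=> 0)) => [|G]; last exact: walk_reverse0.
    by rewrite Ex_cst // mulr0 mul0r addr0 addr_ge0.
  rewrite (eq_Ex (fun G => walk_reverseS R G d_gt1 l)) ExD !ExZ.
  have := ler_wpM2l q0 (IH (ltnW la)).
  have := ler_wpM2l q1 (@Ex_trace_even a l.+1 la aN); rewrite -/A.
  rewrite [q ^+ l.+1]exprS -[l.+1%:R]natr1; have X0 := exprn_ge0 l q0.
  have : 0 <= N * (q * q) * q ^+ l by rewrite !mulr_ge0 ?(ltW N_gt0).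
  move: (q ^+ l) (Ex _) (Ex _) {IH A0} A => X u v B; move: N q l%:R => M p r.
  by move=> p1 p2 p3; lra.
have : forall l, (l <= a)%N -> Ex (fun G => walk_frob R G l) <=
    1 + A + N * (1 + 2 * l%:R ^+ 2 * d%:R) * q ^+ l.
  elim=> [_|l IH la].
    rewrite (eq_Ex (g := fun=> N)) => [|G]; last exact: walk_frob0.
    by rewrite Ex_cst // expr0n /= mulr0 mul0r addr0 !mulr1 lerDr addr_ge0.
  rewrite (eq_Ex (fun G => walk_frobS R G d_gt1 l)) ExD !ExZ.
  have := ler_wpM2l q0 (IH (ltnW la)).
  have := ler_wpM2l q1 (rev l (ltnW la)).
  rewrite [q ^+ l.+1]exprS -[l.+1%:R]natr1; have := exprn_ge0 l q0; have := N_gt0; have := q_gt0.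
  have dq : 1 <= d%:R * q.
    by rewrite ler_pdivlMr // mul1r ler_nat leq_pred.
  have X0 := exprn_ge0 l q0.
  have M0 : 0 <= N * q ^+ l by rewrite mulr_ge0 ?(ltW N_gt0).
  have r0 := ler0n R l; have D0 := ler0n R d.
  have f1 : 0 <= N * q ^+ l * l%:R * q by rewrite mulr_ge0 // mulr_ge0.
  have f2 : 0 <= N * q ^+ l * l%:R * (d%:R * q - 1).
    by rewrite mulr_ge0 ?subr_ge0 // mulr_ge0.
  have f3 : 0 <= N * q ^+ l * (d%:R * q) by rewrite mulr_ge0 // mulr_ge0.
  have f4 : 0 <= N * q ^+ l * l%:R * (d%:R * q) by rewrite !mulr_ge0 // ltW ?N_gt0.
  move: f1 f2 f3 f4 {M0 X0 r0 D0 dq}; move: (q ^+ l) (Ex _) (Ex _) {IH A0 rev} A => X u v B.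
  move: N q l%:R d%:R => M p r D.
  by move=> f1 f2 f3 f4 h1 h2 h3 h4 h5; lra.
by move/(_ a (leqnn a)).
Qed.

Lemma prod_falling_ge k : (k <= n)%N ->
  1 - k%:R ^+ 2 / n%:R <= \prod_(1 <= i < k) ((n - i)%:R / n%:R : R) <= 1.
Proof.
have n0 : 0 < n%:R :> R by rewrite ltr0n.
elim: k => [_|[|k] IH kn].
- by rewrite big_geq // expr0n mul0r subr0 lexx.
- by rewrite big_geq // lexx gerBl divr_ge0 ?exprn_ge0 ?ltW.
have /andP[lb ub] := IH (ltnW kn).
rewrite big_nat_recr //= natrB 1?ltnW //.
set X := \prod_(_ <= _ < _) _ in lb ub *.
have -> : (n%:R - k.+1%:R) / n%:R = 1 - k.+1%:R / n%:R :> R.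
  by rewrite mulrBl divff ?gt_eqF.
have t0 : 0 <= k.+1%:R / n%:R :> R by rewrite divr_ge0 ?ltW.
have t1 : k.+1%:R / n%:R <= 1 :> R by rewrite ler_pdivrMr // mul1r ler_nat ltnW.
have X0 : 0 <= X.
  by apply: prodr_ge0 => i _; rewrite divr_ge0.
apply/andP; split; last by nra.
have e : k.+2%:R ^+ 2 / n%:R = k.+1%:R ^+ 2 / n%:R + 2 * (k.+1%:R / n%:R) + n%:R^-1 :> R.
  by rewrite -[k.+2%:R]natr1; field; rewrite gt_eqF.
have : 0 <= n%:R^-1 :> R by rewrite invr_ge0 ltW.
rewrite e; nra.
Qed.

Definition simple_density k G : R := #|simple_words G k|%:R / d.-1%:R ^+ k.

(** The first moment from below and the second one from above; the term in [q ^+ k]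
    comes from the pairs made of a loop and a rotation or a reversal of it. *)
Lemma Ex_simple_density_var k : (0 < k)%N -> (k <= n)%N -> (8 * k <= n * d)%N ->
  Ex (fun G => (simple_density k G - 1) ^+ 2) <=
  34 * k%:R ^+ 2 / n%:R + 4 * k%:R * q ^+ k.
Proof.
move=> k0 kn kN; have E0 : 0 < d.-1%:R ^+ k :> R by rewrite exprn_gt0.
set E := d.-1%:R ^+ k in E0 *.
have n0 : 0 < n%:R :> R by rewrite ltr0n.
have k0' : 0 <= k%:R :> R by [].
have -> : q ^+ k = E^-1 by rewrite exprVn.
have m1 : 1 - k%:R ^+ 2 / n%:R <= Ex (simple_density k).
  have nd0 : (0 < n * d)%N by rewrite muln_gt0 n_gt0.
  have := Ex_simple_words_lb R nd_even k0 nd0; have /andP[lb _] := prod_falling_ge kn.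
  rewrite -/E => h; rewrite (eq_Ex (g := fun G => E^-1 * #|simple_words G k|%:R)); last first.
    by move=> G; rewrite mulrC.
  rewrite ExZ [leRHS]mulrC ler_pdivlMr //; apply: le_trans h.
  by rewrite mulrC ler_wpM2l // ltW.
have nN : n%:R <= N by rewrite ler_nat leq_pmulr.
have kN' : 8 * k%:R <= N by rewrite -natrM ler_nat.
have DE : (4 * k)%:R = 4 * k%:R :> R by rewrite natrM.
have D0 : 0 < N - 4 * k%:R by have := N_gt0; lra.
have r2 : N / (N - 4 * k%:R) <= 2 by rewrite ler_pdivrMr //; lra.
have r0 : 0 <= N / (N - 4 * k%:R) by rewrite divr_ge0 ?ltW.
have m2 : Ex (fun G => simple_density k G ^+ 2) <=
    1 + 32 * k%:R ^+ 2 / n%:R + 4 * k%:R * E^-1.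
  rewrite (eq_Ex (g := fun G => (E ^+ 2)^-1 * #|simple_words G k|%:R ^+ 2)); last first.
    by move=> G; rewrite /simple_density -/E expr_div_n mulrC.
  rewrite ExZ [leLHS]mulrC ler_pdivrMr ?exprn_gt0 //.
  have kN4 : (4 * k < n * d)%N by apply: leq_trans kN; rewrite ltn_mul2r k0.
  apply: le_trans (Ex_simple_words_sq nd_even k0 kN4 d_gt0 erefl erefl) _.
  rewrite DE -/E (natrM _ 2 k); set D := N - _ in D0 r2 r0 *; set r := N / D in r2 r0 *.
  have -> : N * E / D * (N * E / D) + k%:R * (N * E / D * (2 * k%:R * E / D)) +
      2 * k%:R * (N * E / D) =
      (r ^+ 2 + r * (2 * k%:R ^+ 2 / D) + 2 * k%:R * r / E) * E ^+ 2.
    by rewrite /r; field; rewrite (gt_eqF D0) (gt_eqF E0).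
  rewrite ler_wpM2r ?exprn_ge0 ?(ltW E0) //.
  have t1 : r ^+ 2 <= 1 + 24 * k%:R ^+ 2 / n%:R.
    have le1 : r ^+ 2 <= 1 + 24 * k%:R / N.
      have rE : r - 1 = 4 * k%:R / D.
        by rewrite /r /D; field; rewrite -natrM -/D (gt_eqF D0).
      have sE : r - 1 <= 8 * k%:R / N.
        rewrite rE ler_pdivrMr // mulrAC ler_pdivlMr //.
        have : 0 <= k%:R * (N - 8 * k%:R) by rewrite mulr_ge0 // subr_ge0.
        by rewrite /D; lra.
      have -> : 24 * k%:R / N = 3 * (8 * k%:R / N) by ring.
      have r1 : 0 <= r - 1 by rewrite rE divr_ge0 ?(ltW D0) // mulr_ge0.
      have : 0 <= (r - 1) * (2 - r) by rewrite mulr_ge0 // subr_ge0.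
      by move: sE; set t := 8 * _ / _; lra.
    apply: le_trans le1 _; rewrite lerD2l.
    apply: (@le_trans _ _ (24 * k%:R / n%:R)).
      by rewrite ler_wpM2l ?mulr_ge0 // lef_pV2 ?posrE.
    rewrite ler_wpM2r ?invr_ge0 ?(ltW n0) // ler_wpM2l // ler_eXnr //.
    by rewrite ler1n.
  have t2 : r * (2 * k%:R ^+ 2 / D) <= 8 * k%:R ^+ 2 / n%:R.
    have : 2 * k%:R ^+ 2 / D <= 4 * k%:R ^+ 2 / n%:R.
      rewrite ler_pdivrMr // mulrAC ler_pdivlMr //.
      have : 0 <= k%:R ^+ 2 :> R by rewrite exprn_ge0.
      by rewrite /D; nra.
    have : 0 <= 2 * k%:R ^+ 2 / D by rewrite divr_ge0 ?(ltW D0) // mulr_ge0 ?exprn_ge0.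
    have -> : 8 * k%:R ^+ 2 / n%:R = 2 * (4 * k%:R ^+ 2 / n%:R) :> R by ring.
    by nra.
  have t3 : 2 * k%:R * r / E <= 4 * k%:R * E^-1.
    by rewrite ler_wpM2r ?invr_ge0 ?(ltW E0) //; nra.
  have -> : 32 * k%:R ^+ 2 / n%:R = 24 * k%:R ^+ 2 / n%:R + 8 * k%:R ^+ 2 / n%:R :> R by ring.
  by lra.
rewrite (eq_Ex (g := fun G => simple_density k G ^+ 2 + (- 2) * simple_density k G + 1)).
  rewrite !ExD ExZ Ex_cst //.
  have -> : 34 * k%:R ^+ 2 / n%:R = 32 * k%:R ^+ 2 / n%:R + 2 * (k%:R ^+ 2 / n%:R) :> R by ring.
  by lra.
by move=> G; ring.
Qed.

Definition failure (eps : R) k G : bool :=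
  (N_simp G k)%:R < (1 - eps) * (N_prim G k)%:R.

Lemma failure_tangled eps k G : 0 < eps <= 1 -> (0 < k)%N ->
  failure eps k G -> eps * (N_simp G k)%:R < #|tangled_words G k|%:R.
Proof.
move=> /andP[e0 e1] k0; rewrite /failure => fl.
have := N_prim_le G k0; rewrite -(ler_nat R) natrD.
have : 0 <= (N_simp G k)%:R :> R by [].
move: (N_simp G k)%:R (N_prim G k)%:R #|_|%:R fl => s p t; nra.
Qed.

Lemma simple_density_loops k G : (0 < k)%N ->
  simple_density k G * d.-1%:R ^+ k <= k%:R * (N_simp G k)%:R.
Proof.
move=> k0; rewrite divfK ?gt_eqF ?exprn_gt0 // -natrM ler_nat.
exact: simple_words_loops.
Qed.

(** For bounded [k]: as the counts are integers, failure requires a tangled word. *)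
Lemma Ex_failure_tangled eps k : 0 < eps <= 1 -> (0 < k)%N ->
  Ex (fun G => (failure eps k G)%:R) <= Ex (fun G => #|tangled_words G k|%:R).
Proof.
move=> he k0; apply: Ex_le => G; rewrite ler_nat.
case: (boolP (failure _ _ _)) => // /(failure_tangled he k0) h.
rewrite -(ltr_nat R); apply: le_lt_trans h.
by rewrite mulr_ge0 // ltW; case/andP: he.
Qed.

(** For [k] of logarithmic size: unless simple words are rare, failure requires
    many tangled words. *)
Lemma Ex_failure_middle eps k : 0 < eps <= 1 -> (0 < k)%N ->
  Ex (fun G => (failure eps k G)%:R) <=
  4 * Ex (fun G => (simple_density k G - 1) ^+ 2) +
  2 * k%:R / (eps * d.-1%:R ^+ k) * Ex (fun G => #|tangled_words G k|%:R).
Proof.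
move=> he k0; have /andP[e0 e1] := he; rewrite -!ExZ -ExD; apply: Ex_le => G.
have k0' : 0 < k%:R :> R by rewrite ltr0n.
have E0 : 0 < d.-1%:R ^+ k :> R by rewrite exprn_gt0.
set c := 2 * _ / _.
have c0 : 0 < c by rewrite divr_gt0 ?mulr_gt0.
have sq := sqr_ge0 (simple_density k G - 1).
have T0 : 0 <= #|tangled_words G k|%:R :> R by [].
case: (boolP (failure _ _ _)) => [fl|_]; last first.
  by rewrite addr_ge0 // mulr_ge0 // ltW.
case: (leP (simple_density k G) 2^-1) => [le|gt].
  rewrite -[true%:R]/(1 : R).
  have := mulr_ge0 (ltW c0) T0; move: (c * _) => u.
  move: (simple_density k G) le => z le.
  have : 0 <= (2^-1 - z) * (2^-1 - z + 1) by rewrite mulr_ge0 //; lra.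
  by lra.
suff h : 1 <= c * #|tangled_words G k|%:R.
  by rewrite -[X in X <= _]add0r lerD // mulr_ge0.
have h1 := failure_tangled he k0 fl; have h2 := simple_density_loops G k0.
rewrite /c mulrAC ler_pdivlMr ?mulr_gt0 // mul1r.
set E := _ ^+ k in E0 h2 *.
have h3 : 2^-1 * E <= k%:R * (N_simp G k)%:R.
  by apply: le_trans h2; rewrite ler_wpM2r ?(ltW E0) ?(ltW gt).
have h4 := ler_wpM2l (ltW e0) h3; have h5 := ler_wpM2l (ltW k0') (ltW h1).
by move: h4 h5; move: (N_simp _ _)%:R #|_|%:R => s t h4 h5; lra.
Qed.

(** For larger [k]: failure requires too few simple words or too many closed ones,
    and the latter is controlled by walks of the much shorter length [a]. *)
Lemma Ex_failure_large eps a k : 0 < eps <= 1 -> (0 < k)%N -> (2 * a <= k)%N ->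
  Ex (fun G => (failure eps k G)%:R) <=
  4 / eps ^+ 2 * Ex (fun G => (simple_density k G - 1) ^+ 2) +
  2 / eps * (Ex (fun G => walk_frob R G a) - 1).
Proof.
move=> /andP[e0 e1] k0 ak.
have -> : Ex (fun G => walk_frob R G a) - 1 = Ex (fun G => walk_frob R G a - 1).
  by rewrite ExD Ex_cst.
rewrite -!ExZ -ExD; apply: Ex_le => G.
have k0' : 0 < k%:R :> R by rewrite ltr0n.
have E0 : 0 < d.-1%:R ^+ k :> R by rewrite exprn_gt0.
have sq := sqr_ge0 (simple_density k G - 1).
have F0 : 0 <= walk_frob R G a - 1.
  rewrite -frob_walk_dev // frobE; apply: sumr_ge0 => i _; apply: sumr_ge0 => j _.
  exact: sqr_ge0.
have c1 : 0 < 4 / eps ^+ 2 by rewrite divr_gt0 ?exprn_gt0.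
have c2 : 0 < 2 / eps by rewrite divr_gt0.
have s0 := mulr_ge0 (ltW c1) sq; have s1 := mulr_ge0 (ltW c2) F0.
case: (boolP (failure _ _ _)) => [fl|_]; last by rewrite addr_ge0.
case: (leP (simple_density k G) (1 - eps / 2)) => [le|gt].
  suff h : 1 <= 4 / eps ^+ 2 * (simple_density k G - 1) ^+ 2.
    by rewrite -[X in X <= _]addr0 lerD.
  rewrite mulrAC ler_pdivlMr ?exprn_gt0 // mul1r; move: le.
  move: (simple_density k G) => z le.
  have : 0 <= (1 - eps / 2 - z) * (1 + eps / 2 - z) by rewrite mulr_ge0 //; lra.
  by lra.
suff h : 1 <= 2 / eps * (walk_frob R G a - 1).
  by rewrite -[X in X <= _]add0r lerD.
rewrite mulrAC ler_pdivlMr // mul1r leNgt; apply/negP => Fs.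
have := N_prim_closed G k0; rewrite -(ler_nat R) natrM => h1.
have h2 := closed_words_le_frob R G d_gt1 n_gt0 k0 ak.
have h3 := simple_density_loops G k0.
move: fl; rewrite /failure ltNge => /negP[].
rewrite -(ler_pM2l k0') mulrCA.
set E := _ ^+ k in E0 h2 h3; move: (N_simp _ _)%:R (N_prim _ _)%:R h1 h3 => s p h1 h3.
apply: le_trans h3; apply: (@le_trans _ _ ((1 - eps) * (E * (1 + eps / 2)))).
  rewrite ler_wpM2l ?subr_ge0 //; apply: le_trans h1 _; apply: le_trans h2 _.
  by rewrite ler_wpM2l ?ltW //; lra.
rewrite mulrCA mulrC ler_wpM2r ?(ltW E0) //; apply: le_trans (ltW gt).
by have := sqr_ge0 eps; lra.
Qed.

End Assembly.

(** * Failure probability in the three ranges of lengths *)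

Lemma pow6_le_exp2 L : (L ^ 6 <= 6 ^ 6 * 2 ^ L)%N.
Proof.
have le_exp m : (m.+1 <= 2 ^ m)%N by rewrite ltn_expl.
apply: (@leq_trans ((6 * (L %/ 6).+1) ^ 6)).
  by rewrite leq_exp2r // mulnC ltnW // ltn_ceil.
rewrite expnMn leq_pmul2l ?expn_gt0 //.
apply: (@leq_trans ((2 ^ (L %/ 6)) ^ 6)); first by rewrite leq_exp2r.
by rewrite -expnM leq_pexp2l // leq_trunc_div.
Qed.

Lemma sqr_le_exp2 k : (k ^ 2 <= 4 * 2 ^ k)%N.
Proof.
case: k => [|[|[|k]]] //; elim: k => // k IH.
have : (k.+4 ^ 2 <= 2 * k.+3 ^ 2)%N by nia.
by move=> h; apply: leq_trans h _; rewrite [in X in (_ <= X)%N]expnS; lia.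
Qed.

Section Rate.
Variables (R : archiRealFieldType) (d : nat).
Hypothesis d_ge3 : (3 <= d)%N.

Let Lg n := trunc_log 2 n.
(* The order of all the errors due to walks of logarithmic length. *)
Let x n : R := (Lg n)%:R ^+ 5 / 2 ^+ Lg n.

Lemma log_ratio_small (xi : R) : 0 < xi ->
  exists n0, forall n, (n0 <= n)%N -> [/\ (0 < n)%N, (0 < Lg n)%N & x n <= xi].
Proof.
move=> xi0; pose L0 := (Num.bound ((6 ^ 6)%:R / xi)).+1.
exists (2 ^ L0)%N => n nL.
have n0 : (0 < n)%N by apply: leq_trans nL; rewrite expn_gt0.
have LL : (L0 <= Lg n)%N by apply: trunc_log_max.
have Lp : (0 < Lg n)%N by apply: leq_trans LL.
split=> //; rewrite /x; set L := Lg n in LL Lp *.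
have Lp' : 0 < L%:R :> R by rewrite ltr0n.
have P0 : 0 < 2 ^+ L :> R by rewrite exprn_gt0.
have b1 : (6 ^ 6)%:R / xi <= L%:R.
  apply: (@le_trans _ _ (Num.bound ((6 ^ 6)%:R / xi))%:R).
    by apply/ltW/archi_boundP; rewrite divr_ge0 ?(ltW xi0).
  by rewrite ler_nat (leq_trans _ LL) // leqnSn.
rewrite ler_pdivrMr // -(ler_pM2r Lp') -exprSr.
have := pow6_le_exp2 L; rewrite -(ler_nat R) natrM !natrX => h.
apply: le_trans h _; rewrite [leRHS]mulrAC ler_wpM2r ?(ltW P0) //.
by move: b1; rewrite ler_pdivrMr // mulrC natrX.
Qed.

Variables (eps eta : R).
Hypotheses (eps_gt0 : 0 < eps) (eps_le1 : eps <= 1) (eta_gt0 : 0 < eta).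

Let dR : R := d%:R.
Let dR_ge1 : 1 <= dR. Proof. by rewrite ler1n ltnW // ltnW. Qed.
Let dR_gt0 : 0 < dR. Proof. exact: lt_le_trans dR_ge1. Qed.

(* Chosen so that twice [34 * c], multiplied by [4 / eps ^+ 2], is [eta / 2]. *)
Let c : R := eta * eps ^+ 2 / (32 * 17).
Let c_gt0 : 0 < c.
Proof. by apply: divr_gt0; [apply: mulr_gt0; rewrite ?exprn_gt0 | rewrite mulr_gt0]. Qed.

Lemma variance_small n k : (0 < k)%N -> 16 / (34 * c) <= k%:R ->
  k%:R ^+ 2 <= c * n%:R -> (0 < n)%N ->
  4 / eps ^+ 2 * (34 * k%:R ^+ 2 / n%:R + 4 * k%:R * d.-1%:R^-1 ^+ k) <= eta / 2.
Proof.
move=> k0 kK kc n0.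
have n0' : 0 < n%:R :> R by rewrite ltr0n.
have k0' : 0 < k%:R :> R by rewrite ltr0n.
have t1 : 34 * k%:R ^+ 2 / n%:R <= 34 * c by rewrite ler_pdivrMr // -mulrA ler_wpM2l.
have t2 : 4 * k%:R * d.-1%:R^-1 ^+ k <= 34 * c.
  have P0 : 0 < 2 ^+ k :> R by rewrite exprn_gt0.
  apply: (@le_trans _ _ (4 * k%:R * (2 ^+ k)^-1)).
    rewrite ler_wpM2l ?mulr_ge0 // exprVn lef_pV2 ?posrE ?exprn_gt0 //.
      by rewrite lerXn2r ?nnegrE // ler_nat -ltnS prednK // ltnW // ltnW.
    by rewrite ltr0n -ltnS prednK // ltnW // ltnW.
  rewrite ler_pdivrMr //.
  have h := sqr_le_exp2 k; move: h; rewrite -(ler_nat R) natrM !natrX => h.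
  have c34 : 0 < 34 * c by apply: mulr_gt0.
  move: kK; rewrite ler_pdivrMr // => kK.
  rewrite -(ler_pM2r k0').
  have := ler_wpM2r (ltW P0) kK; have -> : 4 * k%:R * k%:R = 4 * k%:R ^+ 2 :> R by ring.
  lra.
have e2 : 0 < eps ^+ 2 by rewrite exprn_gt0.
rewrite mulrAC ler_pdivrMr //.
have -> : eta / 2 * eps ^+ 2 = 4 * (68 * c) by rewrite /c; field.
by rewrite ler_wpM2l //; lra.
Qed.

(** Three ranges of [k], separated by a constant [K] and by [2 * a], where [a] is
    twice the binary logarithm of [n]: this makes [q ^+ a] of order [n ^- 2] at
    most, while powers of [a] stay negligible with respect to [n]. *)
Lemma failure_rate : exists (n0 : nat) (delta : R), 0 < delta /\
  forall n k, (n0 <= n)%N -> ~~ odd (n * d) -> (0 < k)%N ->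
    k%:R ^+ 2 <= delta * n%:R ->
    Ex (fun G : graph d n => (failure eps k G)%:R) <= eta.
Proof.
(* The errors at logarithmic length sum up to at most 128 * 128 * dR ^+ 2 / eps
   times the ratio bounded by [xi]. *)
pose K := Num.bound (16 / (34 * c)).
have [xi [xi0 xi1 xi2]] : exists xi, [/\ 0 < xi, xi <= 1 / 16 &
    xi <= eps * eta / ((128 * 128) * dR ^+ 2)].
  exists (Num.min (1 / 16) (eps * eta / ((128 * 128) * dR ^+ 2))).
  rewrite lt_min !ge_min !lexx orbT; split=> //.
  by rewrite !divr_gt0 // ?mulr_gt0 // exprn_gt0.
have [n1 n1P] := log_ratio_small xi0.
pose n2 := Num.bound (4 * dR ^+ 2 * K%:R ^+ 4 * dR ^+ K / eta).
exists (maxn n1 n2), (Num.min c (1 / 8)); split.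
  by rewrite lt_min c_gt0 divr_gt0.
move=> n k; rewrite geq_max => /andP[/n1P[n0 L0 xn] nn2] ev k0 kd.
have n0' : 0 < n%:R :> R by rewrite ltr0n.
have k0' : 1 <= k%:R :> R by rewrite ler1n.
have kc : k%:R ^+ 2 <= c * n%:R.
  by apply: le_trans kd _; rewrite ler_wpM2r ?ge_min ?lexx ?(ltW n0').
have kn8R : 8 * k%:R <= n%:R :> R.
  have : k%:R ^+ 2 <= 1 / 8 * n%:R :> R.
    by apply: le_trans kd _; rewrite ler_wpM2r ?ge_min ?lexx ?orbT ?(ltW n0').
  have : k%:R <= k%:R ^+ 2 :> R by rewrite ler_eXnr.
  by lra.
have kn8 : (8 * k <= n)%N by rewrite -(ler_nat R) natrM.
have nd : (n <= n * d)%N by rewrite leq_pmulr // ltnW // ltnW.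
have nN : n%:R <= (n * d)%:R :> R by rewrite ler_nat.
have N0' : 0 < (n * d)%:R :> R by apply: lt_le_trans nN.
have kN : (8 * k <= n * d)%N by apply: leq_trans nd.
have kn : (k <= n)%N by apply: leq_trans kn8; rewrite leq_pmull.
have he : 0 < eps <= 1 by rewrite eps_gt0.
have E0 : 0 < d.-1%:R ^+ k :> R.
  by rewrite exprn_gt0 // ltr0n -ltnS prednK // ltnW // ltnW.
have V := Ex_simple_density_var R ev d_ge3 n0 k0 kn kN.
have tang : Ex (fun G : graph d n => #|tangled_words G k|%:R) <=
    4 * dR ^+ 2 * k%:R ^+ 4 / n%:R * d.-1%:R ^+ k.
  apply: le_trans (Ex_tangled_small R ev d_ge3 n0 k0 _) _.
    by apply: leq_trans kN; rewrite leq_mul2r orbT.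
  rewrite ler_wpM2r ?(ltW E0) // ler_wpM2l ?mulr_ge0 ?exprn_ge0 ?(ltW dR_gt0) //.
  by rewrite lef_pV2 ?posrE.
have [kK|Kk] := ltnP k K.
  apply: le_trans (Ex_failure_tangled d n he k0) _; apply: le_trans tang _.
  have nB : 4 * dR ^+ 2 * K%:R ^+ 4 * dR ^+ K / eta <= n%:R.
    apply: (@le_trans _ _ n2%:R); last by rewrite ler_nat.
    apply/ltW/archi_boundP; rewrite divr_ge0 ?(ltW eta_gt0) //.
    by rewrite !mulr_ge0 ?exprn_ge0 ?(ltW dR_gt0).
  move: nB; rewrite ler_pdivrMr // => nB.
  rewrite mulrAC ler_pdivrMr //; apply: le_trans (_ : _ <= n%:R * eta) _; last by rewrite mulrC.
  apply: le_trans nB; apply: ler_pM.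
  - by rewrite !mulr_ge0 ?exprn_ge0 ?(ltW dR_gt0).
  - exact: ltW.
  - rewrite ler_wpM2l ?mulr_ge0 ?exprn_ge0 ?(ltW dR_gt0) //.
    by rewrite lerXn2r ?nnegrE // ler_nat ltnW.
  apply: (@le_trans _ _ (dR ^+ k)).
    by rewrite lerXn2r ?nnegrE ?(ltW dR_gt0) // ler_nat leq_pred.
  by rewrite ler_weXn2l // ltnW.
have kKR : 16 / (34 * c) <= k%:R.
  apply: (@le_trans _ _ K%:R); last by rewrite ler_nat.
  apply/ltW/archi_boundP; rewrite divr_ge0 //.
  by apply: mulr_ge0 => //; apply: ltW.
have V2 := variance_small k0 kKR kc n0.
have e2 : 0 < eps ^+ 2 by rewrite exprn_gt0.
have V3 : 4 / eps ^+ 2 * Ex (fun G : graph d n => (simple_density R k G - 1) ^+ 2) <= eta / 2.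
  by apply: le_trans V2; rewrite ler_wpM2l // divr_ge0 ?(ltW e2).
pose L := Lg n; pose a := (2 * L)%N.
have P0 : 0 < 2 ^+ L :> R by rewrite exprn_gt0.
have L1 : 1 <= L%:R :> R by rewrite ler1n.
have Pn : 2 ^+ L <= n%:R :> R by rewrite -natrX ler_nat trunc_logP.
have nP : n%:R <= 2 * 2 ^+ L :> R.
  by rewrite -exprS -natrX ler_nat ltnW // trunc_log_ltn.
have x1 : L%:R ^+ 5 <= 1 / 16 * 2 ^+ L :> R.
  by rewrite -ler_pdivrMr //; apply: le_trans xn xi1.
have x2 : L%:R ^+ 5 / 2 ^+ L <= eps * eta / ((128 * 128) * dR ^+ 2) :> R.
  by apply: le_trans xn xi2.
have L15 : L%:R <= L%:R ^+ 5 :> R by rewrite ler_eXnr.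
have aN : (8 * a <= n * d)%N.
  apply: leq_trans nd; rewrite -(ler_nat R) /a !natrM; apply: le_trans Pn.
  by lra.
have x0 : 0 <= L%:R ^+ 5 / 2 ^+ L :> R by rewrite divr_ge0 ?exprn_ge0.
have d2 : 0 < dR ^+ 2 by rewrite exprn_gt0.
have x3 : (128 * 128) * dR ^+ 2 / eps * (L%:R ^+ 5 / 2 ^+ L) <= eta.
  rewrite mulrAC ler_pdivrMr // mulrC -ler_pdivlMr ?mulr_gt0 //.
  by rewrite [eta * _]mulrC.
have c0 : 0 <= 2 / eps by rewrite divr_ge0 ?(ltW eps_gt0).
case: (ltnP k (2 * a)%N) => [ka|ak].
  apply: le_trans (Ex_failure_middle n d_ge3 he k0) _.
  have m1 : 4 * Ex (fun G : graph d n => (simple_density R k G - 1) ^+ 2) <= eta / 2.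
    apply: le_trans V3; rewrite ler_wpM2r ?Ex_ge0 // => [G|]; first exact: sqr_ge0.
    by rewrite ler_pdivlMr // ler_piMr // exprn_ile1 // ltW.
  have cc : 0 <= 2 * k%:R / (eps * d.-1%:R ^+ k) :> R.
    by rewrite divr_ge0 ?mulr_ge0 ?(ltW eps_gt0) ?(ltW E0).
  have m2 := ler_wpM2l cc tang.
  have m2E : 2 * k%:R / (eps * d.-1%:R ^+ k) * (4 * dR ^+ 2 * k%:R ^+ 4 / n%:R * d.-1%:R ^+ k)
      = 8 * dR ^+ 2 / eps * (k%:R ^+ 5 / n%:R).
    by field; rewrite !gt_eqF.
  rewrite m2E in m2.
  have m3 : k%:R ^+ 5 / n%:R <= (32 * 32) * (L%:R ^+ 5 / 2 ^+ L) :> R.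
    rewrite mulrA; apply: ler_pM; rewrite ?invr_ge0 ?exprn_ge0 ?(ltW n0') //.
      have -> : (32 * 32) * L%:R ^+ 5 = (4 * L%:R) ^+ 5 :> R by ring.
      rewrite lerXn2r ?nnegrE ?mulr_ge0 // -natrM ler_nat.
      by rewrite ltnW // (leq_trans ka) // /a mulnA.
    by rewrite lef_pV2 ?posrE.
  have m4 : 8 * dR ^+ 2 / eps * (k%:R ^+ 5 / n%:R) <= eta / 2.
    apply: (@le_trans _ _ (8 * dR ^+ 2 / eps * ((32 * 32) * (L%:R ^+ 5 / 2 ^+ L)))).
      by rewrite ler_wpM2l // divr_ge0 ?(ltW eps_gt0) // mulr_ge0 // ltW.
    have -> : 8 * dR ^+ 2 / eps * ((32 * 32) * (L%:R ^+ 5 / 2 ^+ L)) =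
       (128 * 128) * dR ^+ 2 / eps * (L%:R ^+ 5 / 2 ^+ L) / 2 by field; rewrite !gt_eqF.
    by rewrite ler_wpM2r ?invr_ge0.
  lra.
apply: le_trans (Ex_failure_large ev d_ge3 n0 he k0 ak) _.
have a0 : (0 < a)%N by rewrite /a muln_gt0.
have F := Ex_walk_frob_ub R ev d_ge3 n0 aN a0.
have F1 : 72 * dR ^+ 2 * a%:R ^+ 4 / (n * d)%:R <= (32 * 36) * dR ^+ 2 * (L%:R ^+ 5 / 2 ^+ L).
  have -> : (32 * 36) * dR ^+ 2 * (L%:R ^+ 5 / 2 ^+ L) = (32 * 36) * dR ^+ 2 * L%:R ^+ 5 / 2 ^+ L.
    by rewrite mulrA.
  apply: ler_pM; rewrite ?invr_ge0 ?(ltW N0') //.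
  - by rewrite !mulr_ge0 ?exprn_ge0 ?(ltW dR_gt0).
  - have -> : 72 * dR ^+ 2 * a%:R ^+ 4 = (32 * 36) * dR ^+ 2 * L%:R ^+ 4.
      by rewrite /a natrM; ring.
    have p : 0 <= 32 * 36 * dR ^+ 2.
      by apply: mulr_ge0 (ltW d2); rewrite mulr_ge0.
    by rewrite (ler_wpM2l p) // ler_weXn2l.
  by rewrite lef_pV2 ?posrE //; apply: le_trans Pn nN.
have F2 : (n * d)%:R * (1 + 2 * a%:R ^+ 2 * dR) * d.-1%:R^-1 ^+ a <=
    18 * dR ^+ 2 * (L%:R ^+ 5 / 2 ^+ L).
  have q4 : d.-1%:R^-1 ^+ a <= (2 ^+ L)^-1 * (2 ^+ L)^-1 :> R.
    rewrite exprVn -invfM lef_pV2 ?posrE ?mulr_gt0 ?exprn_gt0 //; last first.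
      by rewrite ltr0n -ltnS prednK // ltnW // ltnW.
    rewrite -exprD addnn -mul2n lerXn2r ?nnegrE //.
    by rewrite ler_nat -ltnS prednK // ltnW // ltnW.
  have t1 : 1 + 2 * a%:R ^+ 2 * dR <= 9 * dR * L%:R ^+ 5.
    have -> : a%:R = 2 * L%:R :> R by rewrite /a natrM.
    have L25 : L%:R ^+ 2 <= L%:R ^+ 5 :> R by rewrite ler_weXn2l.
    have L5 : 1 <= L%:R ^+ 5 :> R by rewrite exprn_ege1.
    by rewrite exprMn; nra.
  have n1' : (n * d)%:R <= 2 * 2 ^+ L * dR :> R by rewrite natrM ler_wpM2r ?(ltW dR_gt0).
  apply: (@le_trans _ _ (2 * 2 ^+ L * dR * (9 * dR * L%:R ^+ 5) * ((2 ^+ L)^-1 * (2 ^+ L)^-1))).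
    have a2 : 0 <= 1 + 2 * a%:R ^+ 2 * dR.
      by rewrite addr_ge0 // mulr_ge0 ?(ltW dR_gt0) // mulr_ge0 ?exprn_ge0.
    apply: ler_pM.
    - by rewrite mulr_ge0 // (ltW N0').
    - by rewrite exprn_ge0 // invr_ge0.
    - by apply: ler_pM n1' t1; rewrite ?(ltW N0').
    - exact: q4.
  rewrite le_eqVlt; apply/orP; left; apply/eqP.
  by field; rewrite gt_eqF.
have F3 : 2 / eps * (Ex (fun G : graph d n => walk_frob R G a) - 1) <= eta / 2.
  apply: (@le_trans _ _ (2 / eps * ((32 * 64) * dR ^+ 2 * (L%:R ^+ 5 / 2 ^+ L)))).
    rewrite ler_wpM2l //; have := mulr_ge0 (ltW d2) x0; move: F F1 F2; rewrite -/dR.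
    by lra.
  apply: (@le_trans _ _ ((128 * 128) * dR ^+ 2 / eps * (L%:R ^+ 5 / 2 ^+ L) / 2)); last first.
    by rewrite ler_wpM2r ?invr_ge0.
  rewrite -subr_ge0.
  have -> : (128 * 128) * dR ^+ 2 / eps * (L%:R ^+ 5 / 2 ^+ L) / 2 -
    2 / eps * ((32 * 64) * dR ^+ 2 * (L%:R ^+ 5 / 2 ^+ L)) =
    (64 * 64) * (dR ^+ 2 / eps * (L%:R ^+ 5 / 2 ^+ L)) by field; rewrite !gt_eqF.
  by rewrite mulr_ge0 // mulr_ge0 // divr_ge0 // ltW.
lra.
Qed.

End Rate.

(** * Convergence of the probability *)

Import numFieldNormedType.Exports.
Local Open Scope classical_set_scope.
Local Open Scope ring_scope.

Theorem theorem1p1 (R : realType) (d : nat) (k : nat -> nat) (eps : R)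
    (hd : (3 <= d)%N)
    (hk_pos : forall n : nat, admissible d n -> (0 < k n)%N)
    (hk : (k n)%:R / Num.sqrt (n%:R : R)
            @[n --> within (admissible d) \oo] --> (0 : R))
    (heps : 0 < eps) :
  Pr R [set G : graph d n |
          (1 - eps) * (N_prim G (k n))%:R <= (N_simp G (k n))%:R]%SET
    @[n --> within (admissible d) \oo] --> (1 : R).
Proof.
apply/cvgrPdist_le => eta eta0.
pose e := Num.min eps 1.
have e0 : 0 < e by rewrite lt_min heps ltr01.
have e1 : e <= 1 by rewrite ge_min lexx orbT.
have [n0 [delta [delta0 rate]]] := failure_rate hd e0 e1 eta0.
have sd0 : 0 < Num.sqrt delta by rewrite sqrtr_gt0.
have near_k : \forall n \near within (admissible d) \oo,
    `|0 - (k n)%:R / Num.sqrt (n%:R : R)| <= Num.sqrt delta.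
  by move/cvgrPdist_le : hk; apply.
have near_n : \forall n \near within (admissible d) \oo, (n0 <= n)%N.
  by apply: cvg_within; exists n0.
have near_adm : \forall n \near within (admissible d) \oo, admissible d n.
  exact: withinT.
near=> n.
have [n_gt0 ev] : admissible d n by near: n.
have n0n : (n0 <= n)%N by near: n.
have kn : `|0 - (k n)%:R / Num.sqrt (n%:R : R)| <= Num.sqrt delta by near: n.
have k0 : (0 < k n)%N by apply: hk_pos.
have n0' : 0 < n%:R :> R by rewrite ltr0n.
have sn0 : 0 < Num.sqrt (n%:R : R) by rewrite sqrtr_gt0.
have kd : (k n)%:R ^+ 2 <= delta * n%:R :> R.
  rewrite sub0r normrN ger0_norm ?divr_ge0 ?(ltW sn0) // ler_pdivrMr // in kn.
  rewrite -[delta]sqr_sqrtr ?(ltW delta0) // -[n%:R]sqr_sqrtr ?(ltW n0') // -exprMn.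
  by rewrite lerXn2r ?nnegrE // mulr_ge0 ?(ltW sn0) ?(ltW sd0).
have fl := rate n (k n) n0n ev k0 kd.
rewrite PrE.
have one : 1 - Ex (fun G : graph d n => (G \in [set G : graph d n |
    (1 - eps) * (N_prim G (k n))%:R <= (N_simp G (k n))%:R]%SET)%:R) =
    Ex (fun G : graph d n =>
      (~~ ((1 - eps) * (N_prim G (k n))%:R <= (N_simp G (k n))%:R))%:R) :> R.
  rewrite -[X in X - _](Ex_cst (1 : R) ev); apply/eqP; rewrite subr_eq -ExD; apply/eqP.
  by apply: eq_Ex => G; rewrite inE; case: (_ <= _); rewrite /= ?add0r ?addr0.
rewrite one ger0_norm; last by apply: Ex_ge0 => G; rewrite ler0n.
apply: le_trans fl; apply: Ex_le => G; rewrite ler_nat.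
case: leP => //= h; rewrite lt0b /failure.
apply: lt_le_trans h _; rewrite ler_wpM2r // lerD2l lerN2.
by rewrite /e ge_min lexx.
Unshelve. all: by end_near.
Qed.
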